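(* For each $\delta>0$ there exists a $p=p_\delta\in(0,1)$ such that for any irrational $\alpha\in\mathbb{R}$ the $p$-continued fraction $$\alpha=a_0+\cfrac{\varepsilon_1}{a_1+\cfrac{\varepsilon_2}{a_2+\cdots}},\qquad \gcd(\varepsilon_n,a_n,\varepsilon_{n+1})=1,$$ of $\alpha$, with convergents $r_n/s_n$ ($n\ge 0$), has the following properties. (1) The convergents are precisely the best approximations to $\alpha$ with respect to $F^{\langle p\rangle}$ (the $L^p$-best approximations to $\alpha$). (2) Each convergent $r_n/s_n$ satisfies $s_n|r_n-s_n\alpha|<\frac{1}{\sqrt5}+\delta$. (3) There exists a constant $M_p$ (depending only on $p$) such that $|\varepsilon_n|\le M_p$ for all $n$.
   Context: For $p\in(0,1)$, $F^{\langle p\rangle}(x,y)=(|x|^p+|y|^p)^{1/p}$ on $\mathbb{R}^2$, and for $t>0$, $F_t^{\langle p\rangle}(x,y)=F^{\langle p\rangle}(t^{-1}x,ty)$. For $P\in\mathbb{R}^2$ put $\mathcal{B}_t(P)=\{P'\in\mathbb{R}^2: F_t^{\langle p\rangle}(P')<F_t^{\langle p\rangle}(P)\}$. A lattice is admissible for a set $S$ if the only lattice point inside $S$ is the origin. $L^p$-best approximation: a rational $r/s$ is an $L^p$-best approximation to $\alpha$ (a best approximation with respect to $F^{\langle p\rangle}$) if there is a $t>1$, depending only on $r/s$, such that for any rational $r'/s'\neq r/s$ one has $F_t^{\langle p\rangle}(s,r-s\alpha)<F_t^{\langle p\rangle}(s',r'-s'\alpha)$. Here rationals are written in lowest terms with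 positive denominator. Convergents of the $p$-continued fraction of an irrational $\alpha$. Let $L_\alpha=(0,1)\mathbb{Z}+(1,-\alpha)\mathbb{Z}$ (which depends only on $\alpha$ modulo $1$). Set $P_{-1}=(0,1)$, $t_{-1}=1$. Given $P_m$ and $t_m$ ($m\ge -1$), let $t_{m+1}$ be the largest $T\geq t_m$ such that $L_\alpha$ is admissible for $\mathcal{B}_t(P_m)$ for all $t\in[t_m,T]$, and let $P_{m+1}$ be the (unique) point of $L_\alpha$ with maximal $x$-coordinate among the finitely many $P'\in L_\alpha$ with $F^{\langle p\rangle}_{t_{m+1}}(P')=F^{\langle p\rangle}_{t_{m+1}}(P_m)$. Write $P_m=(x_m,y_m)$, $s_m=x_m$ and $r_m=y_m+x_m\alpha\in\mathbb{Z}$ for $m\ge0$. The convergents of the $p$-continued fraction are $r_m/s_m$, $m\ge 0$. Coefficients. Let $g_0=\begin{pmatrix} x_0 & y_0 \\ 0 & x_0 \end{pmatrix}$ and $g_m=\begin{pmatrix} x_m & y_m \\ x_{m-1} & y_{m-1} \end{pmatrix}$ for $m\ge1$; define $\tilde a_m,\tilde\varepsilon_m\in\mathbb{Q}$ for $m\ge1$ by $g_m=\begin{pmatrix} \tilde a_m & \tilde\varepsilon_m \\ 1 & 0 \end{pmatrix}g_{m-1}$. Put $a_0=r_0/s_0\in\mathbb{Q}$, $a_m=(\det g_{m-1})\tilde a_m$ for $m\ge1$, $\varepsilon_1=(\det g_0)\tilde\varepsilon_1$, and $\varepsilon_m=(\det g_{m-2})(\det g_{m-1})\tilde\varepsilon_m$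 for $m\ge2$; these $a_m,\varepsilon_m$ ($m\ge 1$) are integers. Finally, successively for $n=1,2,3,\dots$ divide $\varepsilon_n$, $a_n$, $\varepsilon_{n+1}$ (current values) by their greatest common divisor; this does not change the convergents and yields the integers $\varepsilon_n,a_n$ ($n\ge1$) of the $p$-continued fraction, with $\gcd(\varepsilon_n,a_n,\varepsilon_{n+1})=1$. The finite continued fraction $a_0+\frac{\varepsilon_1}{a_1+}\cdots\frac{\varepsilon_n}{a_n}$ equals $r_n/s_n$.
   Formalization: In (1), an L^p-best approximation must also beat the point (0,1), i.e. 1/0 is added as a competitor; with finite rationals only, (1) fails for every p: e.g. p=1/2, irrational α near 0.45, where 0/1 is best for t near 1 but the convergents start with denominator 2. *)

(* Defs.v *)
From HB Require Import structures.
From mathcomp Require Import all_boot all_order all_algebra.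
From mathcomp Require Import all_classical all_reals all_analysis.

Set Implicit Arguments.
Unset Strict Implicit.
Unset Printing Implicit Defensive.

Import Order.TTheory GRing.Theory Num.Theory.
Import numFieldNormedType.Exports.

Local Open Scope classical_set_scope.
Local Open Scope ring_scope.

Definition Lp_form (R : realType) (p : R) (P : R * R) : R :=
  (`|P.1| `^ p + `|P.2| `^ p) `^ p^-1.

Definition Lp_form_at (R : realType) (p t : R) (P : R * R) : R :=
  Lp_form p (t^-1 * P.1, t * P.2).

Definition Lp_ball (R : realType) (p t : R) (P : R * R) : set (R * R) :=
  [set P' | Lp_form_at p t P' < Lp_form_at p t P].

Definition lattice_of (R : realType) (alpha : R) : set (R * R) :=
  [set P | exists i j : int, P = (0, 1) *~ i + (1, - alpha) *~ j].

Definition admissible (R : realType) (L S : set (R * R)) : Prop :=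
  L `&` S = [set 0].

Definition rat_point (R : realType) (alpha : R) (q : rat) : R * R :=
  ((denq q)%:~R, (numq q)%:~R - (denq q)%:~R * alpha).

(* The competitors of q are all r'/s' other than q in Q together with 1/0, whose
   point (0, 1) is the initial point of the p-continued fraction algorithm.
   Without the competitor 1/0, for every p in (0, 1) there are irrational alpha
   with a "best approximation", realized at some t close to 1, that is not a
   convergent: e.g. p = 1/2 and alpha near 0.45, where 0/1 minimizes at t = 1
   among finite rationals but the convergents begin with 1/2. *)
Definition Lp_best_approx (R : realType) (p alpha : R) (q : rat) : Prop :=
  exists t : R, [/\ 1 < t,
    forall q' : rat, q' != q ->
      Lp_form_at p t (rat_point alpha q) < Lp_form_at p t (rat_point alpha q')
    & Lp_form_at p t (rat_point alpha q) < Lp_form_at p t (0, 1)].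

(* One step of the algorithm, from (t_m, P_m) to (t_{m+1}, P_{m+1}). *)
Record pcf_step (R : realType) (p alpha : R)
    (t : R) (P : R * R) (t' : R) (P' : R * R) : Prop := {
  pcf_step_time :
    let A := [set T | t <= T /\ forall u, t <= u <= T ->
                admissible (lattice_of alpha) (Lp_ball p u P)] in
    A t' /\ ubound A t' ;
  pcf_step_point :
    let E := [set Q | lattice_of alpha Q /\
                Lp_form_at p t' Q = Lp_form_at p t' P] in
    E P' /\ forall Q, E Q -> Q.1 <= P'.1
}.

Definition mx22 (R : realType) (a b c d : R) : 'M[R]_2 :=
  \matrix_(i < 2, j < 2)
    if i == 0 then (if j == 0 then a else b) else (if j == 0 then c else d).

Definition pcf_mx (R : realType) (P : nat -> R * R) (m : nat) : 'M[R]_2 :=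
  if m is k.+1 then mx22 (P m).1 (P m).2 (P k).1 (P k).2
  else mx22 (P 0%N).1 (P 0%N).2 0 (P 0%N).1.

(* In the pairs (a, e) of sequences below, only the indices n >= 1 matter. *)
Definition gcd_step (n : nat) (ae : (nat -> int) * (nat -> int)) :
    (nat -> int) * (nat -> int) :=
  let d := gcdz (gcdz (ae.2 n) (ae.1 n)) (ae.2 n.+1) in
  (fun k => if k == n then (ae.1 k %/ d)%Z else ae.1 k,
   fun k => if (k == n) || (k == n.+1) then (ae.2 k %/ d)%Z else ae.2 k).

Fixpoint gcd_steps (n : nat) (ae : (nat -> int) * (nat -> int)) :
    (nat -> int) * (nat -> int) :=
  if n is k.+1 then gcd_step n (gcd_steps k ae) else ae.

(* The p-continued fraction of alpha. The initial values P_{-1} = (0, 1) and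
   t_{-1} = 1 occur only in pcf_init; the sequences pcf_t and pcf_P start at
   m = 0. The fields pcf_ta, pcf_te are the rationals written with tildes, and
   pcf_ra, pcf_re the integers a_m, eps_m before division by the gcds; their
   values at m = 0 are irrelevant. *)
Record pcf (R : realType) (p alpha : R) : Type := {
  pcf_t : nat -> R ;
  pcf_P : nat -> R * R ;
  pcf_init : pcf_step p alpha 1 (0, 1) (pcf_t 0) (pcf_P 0) ;
  pcf_next : forall m,
    pcf_step p alpha (pcf_t m) (pcf_P m) (pcf_t m.+1) (pcf_P m.+1) ;
  pcf_s : nat -> int ;
  pcf_r : nat -> int ;
  pcf_sE : forall m, (pcf_s m)%:~R = (pcf_P m).1 ;
  pcf_rE : forall m, (pcf_r m)%:~R = (pcf_P m).2 + (pcf_P m).1 * alpha ;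
  pcf_ta : nat -> rat ;
  pcf_te : nat -> rat ;
  pcf_mxE : forall m, pcf_mx pcf_P m.+1 =
    mx22 (ratr (pcf_ta m.+1)) (ratr (pcf_te m.+1)) 1 0 *m pcf_mx pcf_P m ;
  pcf_ra : nat -> int ;
  pcf_re : nat -> int ;
  pcf_raE : forall m, (pcf_ra m.+1)%:~R =
    \det (pcf_mx pcf_P m) * ratr (pcf_ta m.+1) ;
  pcf_re1E : (pcf_re 1)%:~R = \det (pcf_mx pcf_P 0) * ratr (pcf_te 1) ;
  pcf_reE : forall m, (pcf_re m.+2)%:~R =
    \det (pcf_mx pcf_P m) * \det (pcf_mx pcf_P m.+1) * ratr (pcf_te m.+2)
}.

Definition pcf_conv (R : realType) (p alpha : R) (c : pcf p alpha) (n : nat) :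
  rat := (pcf_r c n)%:~R / (pcf_s c n)%:~R.

(* The steps after the n-th one change neither a_n nor eps_n. *)
Definition pcf_a (R : realType) (p alpha : R) (c : pcf p alpha) (n : nat) :
  int := (gcd_steps n (pcf_ra c, pcf_re c)).1 n.

Definition pcf_eps (R : realType) (p alpha : R) (c : pcf p alpha) (n : nat) :
  int := (gcd_steps n (pcf_ra c, pcf_re c)).2 n.

(* a_k + e_{k+1}/(a_{k+1} + ... + e_{k+n}/a_{k+n}) *)
Fixpoint cfrac (a e : nat -> rat) (k n : nat) : rat :=
  if n is n'.+1 then a k + e k.+1 / cfrac a e k.+1 n' else a k.

Definition pcf_cfrac (R : realType) (p alpha : R) (c : pcf p alpha) (n : nat) :
  rat :=
  cfrac (fun k => if k == 0%N then pcf_conv c 0 else (pcf_a c k)%:~R)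
        (fun k => (pcf_eps c k)%:~R) 0 n.

(* Main.v *)
(**
With X = |x|^p, Y = |y|^p and T = t^(2p), comparing two points under F_t means
comparing the affine functions X + T Y of T. The p-continued fraction thus walks
along the lower convex hull of the points (X, Y) of the lattice: each P_m is the
unique minimizer, up to sign, strictly between the times t_m and t_(m+1), which
gives (1).

For (2) and (3), every lattice L_alpha rescaled by (1/t, t) contains a nonzero
point with |x|, |y| <= 7 and |xy| <= 1/sqrt 5. On this bounded region
(|x|^p + |y|^p) / 2 is at most (1/sqrt 5 + delta)^(p/2) once p is small, and
by AM-GM the minimality of P_m transfers the bound to |x_m y_m|. The same
comparison bounds the coordinates of both P_m and P_(m-1) rescaled by t_m, hence
the determinants of consecutive points, and eps_m is a product of at most two
such determinants, which the final divisions by gcds can only make smaller.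
*)
Require Import Defs.
From HB Require Import structures.
From mathcomp Require Import all_boot all_order all_algebra.
From mathcomp Require Import all_classical all_reals all_analysis.
From mathcomp Require Import ring lra.

Set Implicit Arguments.
Unset Strict Implicit.
Unset Printing Implicit Defensive.

Import Order.TTheory GRing.Theory Num.Theory.
Import numFieldNormedType.Exports.

Local Open Scope classical_set_scope.
Local Open Scope ring_scope.

(** * Lattice points near the axes *)

(** The discriminant forces B^2 = 1 - 4 A C < c^2, so if both values exceed c in size they have the
    same sign; then A or C exceeds 2 c and 4 A C > 8 c^2 > 1. The two values are those at (1, 1) and
    (1, -1) of the form A m^2 + B m n - C n^2. *)
Lemma indefinite_form_min (R : realFieldType) (A B C c : R) :
  0 < c -> 5 * c ^+ 2 = 1 -> B ^+ 2 + 4 * (A * C) = 1 -> c < A -> c < C ->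
  `|A - C + B| <= c \/ `|A - C - B| <= c.
Proof.
move=> c0 c5 disc cA cC.
have [|h1] := leP `|A - C + B| c; first by left.
have [|h2] := leP `|A - C - B| c; first by right.
exfalso; move: h1 h2.
have Bc : `|B| < c.
  rewrite -ltr_sqr ?nnegrE ?normr_ge0 ?ltW// real_normK ?num_real//; nra.
move: Bc; rewrite ltr_norml => /andP[B1 B2].
case: (ger0P (A - C + B)) => ?; case: (ger0P (A - C - B)) => ?; nra.
Qed.

Lemma int_between (R : realType) (a b : R) : 1 < `|b - a| ->
  exists m : int, [/\ (m%:~R - a) * (m%:~R - b) < 0,
    `|m%:~R - a| < `|b - a| & `|m%:~R - b| < `|b - a|].
Proof.
wlog ab : a b / a <= b.
  move=> W; have [/W//|/ltW/W] := leP a b.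
  by rewrite distrC => H /H[m [h1 h2 h3]]; exists m; split => //; rewrite mulrC.
rewrite ger0_norm ?subr_ge0// => h; exists (Num.floor a + 1).
have := floorD1_gt a; have := floor_le a; rewrite intrD => h1 h2.
by rewrite gtr0_norm ?ltr0_norm; try lra; split; nra.
Qed.

(** The product of the coordinates is a quadratic form in (m, n) of discriminant 1. Once the second
    vector is shifted to v' so that the diagonal coefficients have opposite signs, one of v0, v', v0
    + v', v0 - v' attains Hurwitz's bound c = 1 / sqrt 5. The box size 7 is 2 + 5, from [y0] and
    [y']. *)
Lemma hurwitz_basis (R : realType) (x0 y0 x1 y1 c : R) :
  0 < c -> 5 * c ^+ 2 = 1 -> x0 * y1 - x1 * y0 = 1 ->
  `|x0| <= 1 -> `|y0| <= 2 -> `|x0 * y0| < 1 ->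
  exists m n : int, [/\ (m != 0) || (n != 0),
    `|m%:~R * x0 + n%:~R * x1| <= 7, `|m%:~R * y0 + n%:~R * y1| <= 7 &
    `|(m%:~R * x0 + n%:~R * x1) * (m%:~R * y0 + n%:~R * y1)| <= c].
Proof.
move=> c0 c5 det hx0 hy0 hA.
have [hc|hc] := leP `|x0 * y0| c.
  by exists 1, 0; split; rewrite ?mul0r ?addr0 ?mul1r//; lra.
have [x0n y0n] : x0 != 0 /\ y0 != 0.
  by split; apply/eqP => h; move: hc; rewrite h ?(mul0r, mulr0) normr0; lra.
(* Since c >= 2/5 and |x0 y0| > c, the inverses of [x0] and [y0] are bounded by |y0| / c and |x0| /
   c. *)
have c3 : 1 <= 5/2 * c by nra.
have ix0 : `|x0^-1| <= 5.
  have : 0 < `|x0| by rewrite normr_gt0.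
  move: hc; rewrite normfV normrM => h1 h2.
  rewrite -[leLHS]mul1r ler_pdivrMr//; nra.
have iy0 : `|y0^-1| <= 5/2.
  have : 0 < `|y0| by rewrite normr_gt0.
  move: hc; rewrite normfV normrM => h1 h2.
  rewrite -[leLHS]mul1r ler_pdivrMr//; nra.
(* These are the two shifts at which a coordinate of the second vector vanishes. Their gap is 1 /
   |x0 y0| > 1, and a shift strictly between them gives |x'| <= 1 / |y0| and |y'| <= 1 / |x0|. *)
have := @int_between R (- (x1 / x0)) (- (y1 / y0)).
have -> : - (y1 / y0) - - (x1 / x0) = - (x0 * y0)^-1.
  by rewrite -[(_ * _)^-1]mul1r -det; field; apply/andP.
rewrite normrN normfV invf_gt1 ?normr_gt0 ?mulf_neq0// => /(_ hA)[m].
rewrite !opprK => -[hm hmx hmy].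
(* The integer shift makes x' y' and x0 y0 of opposite signs, so that the
   quadratic form of the new basis is indefinite with discriminant 1. *)
set x' := m%:~R * x0 + x1; set y' := m%:~R * y0 + y1.
have x'E : x' = x0 * (m%:~R + x1 / x0) by rewrite /x'; field.
have y'E : y' = y0 * (m%:~R + y1 / y0) by rewrite /y'; field.
have hx' : `|x'| <= 5/2.
  rewrite x'E normrM (le_trans (ler_wpM2l _ (ltW hmx)))//.
  by rewrite -normfV -normrM invfM mulrA mulfV// mul1r.
have hy' : `|y'| <= 5.
  rewrite y'E normrM (le_trans (ler_wpM2l _ (ltW hmy)))//.
  by rewrite -normfV -normrM invfM mulrCA mulfV// mulr1.
have det' : x0 * y' - x' * y0 = 1 by rewrite -det /x' /y'; ring.
have sg : (x0 * y0) * (x' * y') < 0.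
  rewrite x'E y'E; set u := _ + x1 / x0 in hm *; set v := _ + y1 / y0 in hm *.
  have -> : x0 * y0 * (x0 * u * (y0 * v)) = (x0 * y0) ^+ 2 * (u * v) by ring.
  by rewrite pmulr_rlt0// exprn_even_gt0//= mulf_neq0.
have [hc'|hc'] := leP `|x' * y'| c.
  exists m, 1; split; rewrite ?mul1r ?orbT//.
    by apply: le_trans hx' _; lra.
  by apply: le_trans hy' _; lra.
have [h|h] : `|(x0 + x') * (y0 + y')| <= c \/ `|(x0 - x') * (y0 - y')| <= c.
  have [p0|n0] := ltP 0 (x0 * y0).
    have n' : x' * y' < 0 by rewrite pmulr_rlt0 in sg.
    have := @indefinite_form_min _ (x0 * y0) (x0 * y' + x' * y0) (- (x' * y')) c.
    rewrite (_ : _ + _ + _ = (x0 + x') * (y0 + y')); last by ring.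
    rewrite (_ : _ - _ - _ = (x0 - x') * (y0 - y')); last by ring.
    apply=> //.
    - by transitivity ((x0 * y' - x' * y0) ^+ 2); [ring|rewrite det' expr1n].
    - by rewrite -(gtr0_norm p0).
    - by rewrite -(ltr0_norm n').
  have {}n0 : x0 * y0 < 0 by rewrite lt_neqAle n0 mulf_neq0.
  have p' : 0 < x' * y' by rewrite nmulr_rlt0 in sg.
  have := @indefinite_form_min _ (x' * y') (x0 * y' + x' * y0) (- (x0 * y0)) c.
  rewrite (_ : _ + _ + _ = (x0 + x') * (y0 + y')); last by ring.
  rewrite (_ : _ - _ - _ = (x0 - x') * (y0 - y')); last by ring.
  apply=> //.
  - by transitivity ((x0 * y' - x' * y0) ^+ 2); [ring|rewrite det' expr1n].
  - by rewrite -(gtr0_norm p').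
  - by rewrite -(ltr0_norm n0).
- exists (m + 1), 1; split; first by rewrite orbT.
  + rewrite mul1r (_ : _ + _ = x0 + x'); last by rewrite /x' intrD; ring.
    by rewrite (le_trans (ler_normD _ _))//; lra.
  + rewrite mul1r (_ : _ + _ = y0 + y'); last by rewrite /y' intrD; ring.
    by rewrite (le_trans (ler_normD _ _))//; lra.
  + rewrite !mul1r (_ : _ + x1 = x0 + x'); last by rewrite /x' intrD; ring.
    by rewrite (_ : _ + y1 = y0 + y')//; rewrite /y' intrD; ring.
exists (1 - m), (-1); split; first by rewrite orbT.
+ rewrite mulN1r (_ : _ - _ = x0 - x'); last by rewrite /x' intrB; ring.
  by rewrite (le_trans (ler_normB _ _))//; lra.
+ rewrite mulN1r (_ : _ - _ = y0 - y'); last by rewrite /y' intrB; ring.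
  by rewrite (le_trans (ler_normB _ _))//; lra.
+ rewrite !mulN1r (_ : _ - x1 = x0 - x'); last by rewrite /x' intrB; ring.
  by rewrite (_ : _ - y1 = y0 - y')//; rewrite /y' intrB; ring.
Qed.

(** Pigeonhole: among the N + 1 fractional parts of k alpha, 0 <= k <= N, two lie in the same
    interval of length 1 / N. *)
Lemma dirichlet (R : realType) (alpha : R) (N : nat) : (0 < N)%N ->
  exists s r : int, [/\ 0 < s, (s <= N)%R & `|r%:~R - s%:~R * alpha| * N%:R < 1].
Proof.
move=> N0; have NR : 0 < N%:R :> R by rewrite ltr0n.
pose fr k : R := k%:R * alpha - (Num.floor (k%:R * alpha))%:~R.
have fr01 k : 0 <= fr k < 1.
  by rewrite subr_ge0 floor_le/= ltrBlDr -[1]/(1%:~R) -intrD addrC floorD1_gt.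
have flP k : 0 <= N%:R * fr k by rewrite mulr_ge0//; case/andP: (fr01 k).
have flN k : (Num.truncn (N%:R * fr k) < N)%N.
  rewrite truncn_lt_nat// -[ltRHS]mulr1 ltr_pM2l//; by case/andP: (fr01 k).
pose f (k : 'I_N.+1) : 'I_N := Ordinal (flN k).
have /injectivePn[i [j ij fij]] : ~~ injectiveb f.
  by apply/negP => /injectiveP /leq_card; rewrite !card_ord ltnn.
wlog lt_ij : i j ij fij / (i < j)%N.
  move=> W; have := ij; rewrite -val_eqE neq_ltn => /orP[/W|]; first exact.
  by move=> /W; apply=> //; rewrite eq_sym.
exists (j%:Z - i%:Z), (Num.floor (j%:R * alpha) - Num.floor (i%:R * alpha)).
split; first by rewrite subr_gt0 ltz_nat.
  by rewrite (@le_trans _ _ j%:Z) ?gerBl// lez_nat -ltnS.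
have tE : Num.truncn (N%:R * fr i) = Num.truncn (N%:R * fr j) by case: fij.
rewrite -[N%:R]ger0_norm ?ltW// -normrM.
rewrite (_ : (_ - _) * _ = N%:R * fr i - N%:R * fr j); last by rewrite /fr !intrB; ring.
have /andP[] := truncn_itv (flP i); have /andP[] := truncn_itv (flP j).
rewrite tE -natr1 => *; rewrite ltr_norml; apply/andP; split; lra.
Qed.

Lemma fraction_multiple (s r : int) (q : rat) : 0 < s -> q = r%:~R / s%:~R ->
  exists k : int, [/\ 0 < k, s = k * denq q & r = k * numq q].
Proof.
move=> + ->; have := divqP r s; case=> [//|k x k0 s0].
by exists k; split => //; rewrite -(pmulr_lgt0 _ (denq_gt0 x)).
Qed.

(** Dirichlet's theorem supplies a short vector at scale t; made primitive, it is completed by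
    Bezout to a basis of determinant 1, on which [hurwitz_basis] lowers the product to c. *)
Lemma small_lattice_point (R : realType) (alpha t c : R) :
    1 <= t -> 0 < c -> 5 * c ^+ 2 = 1 ->
  exists s r : int, [/\ (s != 0) || (r != 0), `|t^-1 * s%:~R| <= 7,
    `|t * (r%:~R - s%:~R * alpha)| <= 7 & `|s%:~R * (r%:~R - s%:~R * alpha)| <= c].
Proof.
move=> t1 c0 c5; have t0 : 0 < t by lra.
(* With this N, the reduced denominator d satisfies d <= N <= t, while |y| N < 1 and t <= 2 N: hence
   d / t <= 1, |t y| <= 2 and d |y| < 1, as [hurwitz_basis] requires. *)
set N := Num.truncn t.
have N0 : (0 < N)%N by rewrite truncn_gt0.
have /andP[Nt tN] : N%:R <= t < N.+1%:R by apply: truncn_itv; lra.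
have [s [r [s0 sN hr]]] := dirichlet alpha N0.
pose q : rat := r%:~R / s%:~R.

have [k [k0 sE rE]] := fraction_multiple s0 (erefl q).
have [u [v uv]] := Bezoutz (denq q) (numq q).
have {}uv : u * denq q + v * numq q = 1.
  by rewrite uv; apply/eqP; have := coprime_num_den q; rewrite coprime_sym.
set d := denq q in sE uv *; set n := numq q in rE uv *.
pose y : R := n%:~R - d%:~R * alpha.
have d0 : 0 < d by exact: denq_gt0.
have k1 : 1 <= k%:~R :> R by rewrite ler1z -gtz0_ge1.
have dN : d%:~R <= N%:R :> R.
  rewrite -[N%:R]/(N%:Z%:~R) ler_int (le_trans _ sN)// sE.
  by rewrite ler_peMl ?(ltW d0)// -gtz0_ge1.
have dR : 1 <= d%:~R :> R by rewrite ler1z -gtz0_ge1.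
have {}hr : `|y| * N%:R < 1.
  apply: le_lt_trans hr; rewrite ler_wpM2r//.
  rewrite rE sE (_ : _ - _ = k%:~R * y); last by rewrite /y !intrM; ring.
  by rewrite normrM ger0_norm ?ler_peMl//; lra.
have NR : 1 <= N%:R :> R by rewrite ler1n.
have tN2 : t <= 2 * N%:R by rewrite -natr1 in tN; lra.
have y0 := normr_ge0 y.
have [||||m [l [h1 h2 h3 h4]]] := @hurwitz_basis _ (d%:~R / t) (t * y)
    (- v%:~R / t) (t * (u%:~R + v%:~R * alpha)) c c0 c5.
- rewrite -[RHS]/(1%:~R) -uv !(intrD, intrM) /y; field; lra.
- by rewrite ger0_norm ?ler_pdivrMr ?divr_ge0//; lra.
- by rewrite normrM gtr0_norm//; nra.
- rewrite (_ : _ * _ = d%:~R * y); last by field; lra.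
  by rewrite normrM ger0_norm; nra.
exists (m * d - l * v), (m * n + l * u).
have E1 : t^-1 * (m * d - l * v)%:~R = m%:~R * (d%:~R / t) + l%:~R * (- v%:~R / t).
  by rewrite intrB !intrM; ring.
have E2 : t * ((m * n + l * u)%:~R - (m * d - l * v)%:~R * alpha) =
    m%:~R * (t * y) + l%:~R * (t * (u%:~R + v%:~R * alpha)).
  by rewrite intrB intrD !intrM /y; ring.
split; rewrite ?E1 ?E2//; last first.
  rewrite -E1 -E2 in h4; apply: le_trans h4; rewrite le_eqVlt; apply/orP; left.
  by apply/eqP; congr `|_|; field; rewrite gt_eqF.
apply: contraTT h1; rewrite !negb_or !negbK => /andP[/eqP e1 /eqP e2].
(* The change of basis is unimodular, so m and l are integer combinations of the two vanishing
   coordinates. *)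
have -> : m = 0.
  transitivity (u * (m * d - l * v) + v * (m * n + l * u)); last by rewrite e1 e2; ring.
  by rewrite -[LHS]mulr1 -uv; ring.
have -> : l = 0.
  transitivity (d * (m * n + l * u) - n * (m * d - l * v)); last by rewrite e1 e2; ring.
  by rewrite -[LHS]mulr1 -uv; ring.
by [].
Qed.

(** * Comparison of power sums with products *)

(** From exp z <= 1 / (1 - z) and exp (- z) <= 1 / (1 + z) the sum is at most 2 / (1 - z^2), and (2
    + 4 z^2) (1 - z^2) >= 2 exactly because z^2 <= 1/2. *)
Lemma expRD_oppr_le (R : realType) (z : R) : z ^+ 2 <= 2^-1 ->
  expR z + expR (- z) <= 2 + 4 * z ^+ 2.
Proof.
move=> z2.
have P1 : 0 < expR z := expR_gt0 z. have P2 : 0 < expR (- z) := expR_gt0 (- z).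
have E : expR z * expR (- z) = 1 by rewrite -expRD subrr expR0.
have h1 := expR_ge1Dx z; have h2 := expR_ge1Dx (- z).
have a1 : expR z * (1 - z) <= 1 by rewrite -[leRHS]E ler_pM2l//; lra.
have a2 : expR (- z) * (1 + z) <= 1 by rewrite -[leRHS]E [leRHS]mulrC ler_pM2l.
have z1 : `|z| < 1.
  by rewrite -ltr_sqr ?nnegrE// real_normK ?num_real//; nra.
move: z1; rewrite ltr_norml => /andP[z1 z1'].
have b1 : (expR z + expR (- z)) * (1 - z ^+ 2) <= 2 by nra.
rewrite -(@ler_pM2r _ (1 - z ^+ 2)); last by nra.
apply: le_trans b1 _.
have := sqr_ge0 z; nra.
Qed.

(** On the hyperbola x y = c the left side is c^p (2 + 2 cosh (p w)) with w = ln (x^2 / c) bounded,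
    which exceeds 4 c^p only to second order in p, whereas 4 (c + d)^p exceeds it to first order. *)
Lemma powR_sum_bound (R : realType) (c d K : R) : 0 < c -> 0 < d -> 0 < K -> c <= K ^+ 2 ->
  exists p : R, 0 < p < 1 /\ forall x y : R, 0 <= x <= K -> 0 <= y <= K -> x * y <= c ->
    (x `^ p + y `^ p) ^+ 2 < 4 * (c + d) `^ p.
Proof.
move=> c0 d0 K0 cK.
pose eta := ln (1 + d / c).
have eta0 : 0 < eta by rewrite ln_gt0// ltrDl divr_gt0.
pose W := ln (K ^+ 2 / c).
have W0 : 0 <= W by rewrite ln_ge0// ler_pdivlMr// mul1r.
(* The middle factor gives p W^2 < eta; the last gives p W <= 1/4, within the range of
   [expRD_oppr_le]. *)
pose p := 4^-1 * (eta / (eta + 1 + W ^+ 2)) * (1 + W)^-1.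
have W2 := sqr_ge0 W.
have den0 : 0 < eta + 1 + W ^+ 2 by lra.
have q0 : 0 < eta / (eta + 1 + W ^+ 2) by exact: divr_gt0.
have iW0 : 0 < (1 + W)^-1 by rewrite invr_gt0; lra.
have p0 : 0 < p by rewrite !mulr_gt0// invr_gt0.
have q1 : eta / (eta + 1 + W ^+ 2) <= 1 by rewrite ler_pdivrMr//; lra.
have iW1 : (1 + W)^-1 <= 1 by rewrite invf_le1; lra.
have pW : p * W <= 4^-1.
  have : (1 + W)^-1 * W <= 1 by rewrite mulrC ler_pdivrMr; lra.
  have : 0 <= (1 + W)^-1 * W by rewrite mulr_ge0// ltW.
  rewrite /p -mulrA; nra.
have p1 : p < 1 by rewrite /p; nra.
have pWe : p * W ^+ 2 < eta.
  have : eta / (eta + 1 + W ^+ 2) * W ^+ 2 < eta.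
    by rewrite mulrAC ltr_pdivrMr// ltr_pM2l//; lra.
  have : 0 <= eta / (eta + 1 + W ^+ 2) * W ^+ 2 by rewrite mulr_ge0// ltW.
  rewrite /p; set u := eta / _ => ? ?.
  rewrite (_ : _ * _ = 4^-1 * (1 + W)^-1 * (u * W ^+ 2)); last by ring.
  nra.
clearbody p; exists p; split; first by rewrite p0.
move=> x y /andP[x0 xK] /andP[y0 yK] xy.
(* The point (x, y) is dominated by (x', c / x') on the hyperbola; the maximum with c / K keeps x'
   positive and c / x' at most K. *)
pose x' := Num.max x (c / K).
have cK0 : 0 < c / K by exact: divr_gt0.
have x'0 : 0 < x' by rewrite lt_max cK0 orbT.
have x'K : x' <= K by rewrite ge_max xK ler_pdivrMr.
have y'0 : 0 < c / x' by exact: divr_gt0.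
have xx' : x <= x' by rewrite le_max lexx.
have yy' : y <= c / x'.
  rewrite ler_pdivlMr// /x'; case: (leP x (c / K)) => h; last by rewrite mulrC.
  by rewrite mulrC -mulrA ler_piMr ?(ltW c0)// mulrC ler_pdivrMr ?mul1r.
have pn : p \is Num.nneg by rewrite nnegrE ltW.
pose w := ln (x' ^+ 2 / c).
have x2c : 0 < x' ^+ 2 / c by rewrite divr_gt0// exprn_gt0.
have wW : w ^+ 2 <= W ^+ 2.
  have w1 : w <= W.
    rewrite ler_ln ?posrE ?divr_gt0 ?exprn_gt0// ler_pM2r ?invr_gt0//.
    by rewrite ler_sqr ?nnegrE//; lra.
  have w2 : - W <= w.
    rewrite -lnV ?posrE ?divr_gt0 ?exprn_gt0// ler_ln ?posrE ?invr_gt0 ?divr_gt0 ?exprn_gt0//.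
    rewrite invf_div ler_pdivlMr// mulrAC -expr2 -expr_div_n.
    rewrite ler_sqr ?nnegrE ?(ltW cK0) ?(ltW x'0)//.
    by rewrite /x' le_max lexx orbT.
  nra.
have cp0 : 0 < c `^ p by rewrite powR_gt0.
have S : (x' `^ p + (c / x') `^ p) ^+ 2 = c `^ p * (2 + (expR (p * w) + expR (- (p * w)))).
  have e1 : x' `^ p * (c / x') `^ p = c `^ p.
    by rewrite -powRM ?ltW// mulrCA divff ?mulr1 ?gt_eqF.
  have ew : x' ^+ 2 / c = expR w by rewrite lnK.
  have e2 : x' `^ p ^+ 2 = c `^ p * expR (p * w).
    rewrite expr2 -powRM ?ltW// -expr2.
    rewrite (_ : x' ^+ 2 = c * (x' ^+ 2 / c)); last by rewrite mulrCA divff ?mulr1 ?gt_eqF.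
    have pE : expR w `^ p = expR (p * w) by rewrite /powR gt_eqF ?expR_gt0// expRK.
    by rewrite powRM ?(ltW c0) ?(ltW x2c)// ew pE.
  have e3 : (c / x') `^ p ^+ 2 = c `^ p * expR (- (p * w)).
    rewrite expRN -(mulfK (lt0r_neq0 (expR_gt0 (p * w))) (_ ^+ 2)); congr (_ * _).
    apply: (mulfI (lt0r_neq0 cp0)); rewrite mulrCA -e2 -exprMn mulrC e1 expr2//.
  rewrite sqrrD e2 e3 e1; ring.
have le1 : (x `^ p + y `^ p) ^+ 2 <= (x' `^ p + (c / x') `^ p) ^+ 2.
  rewrite ler_sqr ?nnegrE ?addr_ge0 ?powR_ge0//.
  by rewrite lerD// ge0_ler_powR// ?nnegrE; lra.
apply: le_lt_trans le1 _; rewrite S.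
have -> : (c + d) `^ p = c `^ p * expR (p * eta).
  rewrite (_ : c + d = c * (1 + d / c)); last by field; lra.
  have cd : 0 < 1 + d / c by rewrite addr_gt0// divr_gt0.
  rewrite powRM ?ltW//; congr (_ * _).
  by rewrite /powR gt_eqF.
rewrite mulrCA ltr_pM2l//.
(* The chain is 2 + 2 cosh (p w) <= 4 + 4 (p w)^2 < 4 (1 + p eta) <= 4 exp (p eta). *)
have := expR_ge1Dx (p * eta).
have pw2 : (p * w) ^+ 2 <= (p * W) ^+ 2 by rewrite !exprMn ler_wpM2l ?sqr_ge0.
have pW2 : (p * W) ^+ 2 <= 16^-1.
  have : 0 <= p * W by rewrite mulr_ge0// ltW.
  nra.
have := @expRD_oppr_le _ (p * w).
have : (p * w) ^+ 2 < p * eta.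
  by rewrite (le_lt_trans pw2)// exprMn [p ^+ 2]expr2 -mulrA ltr_pM2l.
move=> h1 h2 h3; have {}h2 := h2 ltac:(lra).
lra.
Qed.

(** * Steps of the algorithm *)

Lemma ltr_powR2 (R : realType) (r x y : R) : 0 < r -> 0 <= x -> 0 <= y ->
  (x `^ r < y `^ r) = (x < y).
Proof.
move=> r0 x0 y0; have [xy|yx] := ltP x y; first by rewrite gt0_ltr_powR ?nnegrE.
by apply/negbTE; rewrite -leNgt ge0_ler_powR ?nnegrE// ltW.
Qed.

Lemma ler_powR2 (R : realType) (r x y : R) : 0 < r -> 0 <= x -> 0 <= y ->
  (x `^ r <= y `^ r) = (x <= y).
Proof. by move=> r0 x0 y0; rewrite !leNgt ltr_powR2. Qed.

Lemma powR_ge1 (R : realType) (r x : R) : 0 < r -> 0 <= x ->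
  (1 <= x `^ r) = (1 <= x).
Proof. by move=> r0 x0; rewrite -[RHS](@ler_powR2 _ r)// powR1. Qed.

Lemma powR_le1 (R : realType) (r x : R) : 0 < r -> 0 <= x ->
  (x `^ r <= 1) = (x <= 1).
Proof. by move=> r0 x0; rewrite -[RHS](@ler_powR2 _ r)// powR1. Qed.

Lemma eqr_powR2 (R : realType) (r x y : R) : 0 < r -> 0 <= x -> 0 <= y ->
  (x `^ r == y `^ r) = (x == y).
Proof. by move=> r0 x0 y0; rewrite !eq_le !ler_powR2. Qed.

(** Sublevel sets are finite, so a minimizer exists. Keeping the largest one matches the rule that
    the next point has maximal x-coordinate. *)
Lemma exists_argmin_nat (R : realDomainType) (S : pred nat) (f : nat -> R) :
  (exists s, S s) ->
  (forall c, exists N, forall s, S s -> f s <= c -> (s <= N)%N) ->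
  exists s, [/\ S s, forall s', S s' -> f s <= f s'
    & forall s', S s' -> f s' = f s -> (s' <= s)%N].
Proof.
move=> [s0 Ss0] bnd; have [N hN] := bnd (f s0).
have s0N : (s0 < N.+1)%N by rewrite ltnS hN.
have [i Si mini] := @arg_minP _ R _ (Ordinal s0N) (fun i : 'I_N.+1 => S i)
  (fun i : 'I_N.+1 => f i) Ss0.
have minf s : S s -> f i <= f s.
  move=> Ss; have [sN|Ns] := leqP s N; first exact: (mini (Ordinal (sN : (s < N.+1)%N))).
  have [|/ltW h] := leP (f s) (f s0); first by move/(hN _ Ss); rewrite leqNgt Ns.
  exact: le_trans (mini (Ordinal s0N) Ss0) h.
have ex : exists s, S s && (f s == f i) by exists i; rewrite Si eqxx.
have ub s : S s && (f s == f i) -> (s <= N)%N.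
  by case/andP => Ss /eqP e; apply: hN => //; rewrite e; exact: (mini (Ordinal s0N) Ss0).
have [m /andP[Sm /eqP fm] maxm] := ex_maxnP ex ub.
exists m; split => //; first by rewrite fm.
by move=> s' Ss' e; apply: maxm; rewrite Ss' e fm eqxx.
Qed.

Lemma exists_nearest_int (R : realType) (x : R) :
  exists n : int, forall m : int, `|n%:~R - x| <= `|m%:~R - x|.
Proof.
exists (Num.floor (x + 2^-1)) => m.
have := floor_le (x + 2^-1); have := floorD1_gt (x + 2^-1).
set n := Num.floor _; rewrite intrD => h1 h2.
have hn : `|n%:~R - x| <= 2^-1 by rewrite ler_norml; apply/andP; split; lra.
have [->//|nm] := eqVneq m n; apply: le_trans hn _.
have : (1 <= `|m - n|)%R by rewrite -gtz0_ge1 normr_gt0 subr_eq0.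
rewrite -(ler1z R) intr_norm intrB ler_normr => /orP[] h; rewrite ler_normr;
  apply/orP; [left|right]; lra.
Qed.

Definition lpoint (R : realType) (alpha : R) (s r : int) : R * R :=
  (s%:~R, r%:~R - s%:~R * alpha).

Lemma lattice_ofP (R : realType) (alpha : R) P :
  lattice_of alpha P <-> exists s r : int, P = lpoint alpha s r.
Proof.
have E (i j : int) : (0, 1) *~ i + (1, - alpha) *~ j = lpoint alpha j i.
  rewrite /lpoint; apply/eqP; rewrite xpair_eqE; apply/andP; split; apply/eqP.
    by rewrite /= !raddfMz/= mul0rz add0r.
  by rewrite /= !raddfMz/= mulNrz mulrzl.
by split=> [[i [j ->]]|[s [r ->]]]; [exists j, i|exists r, s]; rewrite E.
Qed.

Section lattice.
Variables (R : realType) (alpha : R).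
Hypothesis irr : irrational alpha.
Local Notation L := (lattice_of alpha).
Local Notation pt := (lpoint alpha).

Lemma lpoint_in s r : L (pt s r).
Proof. by apply/lattice_ofP; exists s, r. Qed.

Lemma lattice_opp P : L P -> L (- P).
Proof.
move=> /lattice_ofP[s [r ->]]; apply/lattice_ofP; exists (- s), (- r).
by rewrite /lpoint; congr pair; rewrite /= !rmorphN/=; ring.
Qed.

Lemma int_irrational (s r : int) : r%:~R = s%:~R * alpha -> s = 0 /\ r = 0.
Proof.
move=> e; have [s0|s0] := eqVneq s 0.
  by split => //; move: e; rewrite s0 mul0r => /eqP; rewrite intr_eq0 => /eqP.
exfalso; apply: irr; exists (r%:~R / s%:~R) => //.
by rewrite fmorph_div/= !ratr_int e mulrAC divff ?mul1r// intr_eq0.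
Qed.

Lemma lpoint_eq0 s r : (pt s r).2 = 0 -> s = 0 /\ r = 0.
Proof. by move/eqP; rewrite subr_eq0 => /eqP /int_irrational. Qed.

Lemma lattice_snd_neq0 P : L P -> P != 0 -> P.2 != 0.
Proof.
move=> /lattice_ofP[s [r ->]]; apply: contra => /eqP /lpoint_eq0[-> ->].
by rewrite /lpoint mul0r subr0.
Qed.


Lemma exists_lattice_near_axis (e : R) : 0 < e ->
  exists s r : int, 0 < s /\ `|(pt s r).2| < e.
Proof.
move=> e0; set N := (Num.truncn e^-1).+1.
have [s [r [s0 _ h]]] := dirichlet alpha (isT : (0 < N)%N).
exists s, r; split => //; have := truncnS_gt e^-1; rewrite -/N => hN.
have NR : 0 < N%:R :> R by rewrite ltr0n.
apply: lt_trans (_ : N%:R^-1 < e).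
  by rewrite -[ltRHS]mul1r ltr_pdivlMr.
by rewrite -[e]invrK ltf_pV2// posrE invr_gt0.
Qed.

Variable p : R.
Hypothesis p0 : 0 < p.

(** At [T = scale t] this is t^p times the p-th power of F_t. It is affine in [T], which all
    comparisons below exploit. *)
Definition cost (T : R) (P : R * R) := `|P.1| `^ p + T * `|P.2| `^ p.

Definition scale (t : R) := (t `^ p) ^+ 2.

Lemma scale_gt0 t : 0 < t -> 0 < scale t.
Proof. by move=> t0; rewrite exprn_gt0// powR_gt0. Qed.

Lemma ler_scale t u : 0 < t -> 0 < u -> (scale t <= scale u) = (t <= u).
Proof.
by move=> t0 u0; rewrite ler_sqr ?nnegrE ?powR_ge0// ler_powR2// ltW.
Qed.

Lemma ltr_scale t u : 0 < t -> 0 < u -> (scale t < scale u) = (t < u).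
Proof. by move=> t0 u0; rewrite !ltNge ler_scale. Qed.

Lemma scale1 : scale 1 = 1.
Proof. by rewrite /scale powR1 expr1n. Qed.

Lemma scale_surj T : 0 < T -> exists2 t, 0 < t & scale t = T.
Proof.
move=> T0; exists (T `^ (2 * p)^-1); first exact: powR_gt0.
rewrite /scale -powR_mulrn ?powR_ge0// -!powRrM.
rewrite (_ : _ * _ = 1) ?powRr1 ?ltW//; field; exact: lt0r_neq0.
Qed.

Lemma cost_ge0 T P : 0 < T -> 0 <= cost T P.
Proof. by move=> T0; rewrite addr_ge0 ?mulr_ge0 ?powR_ge0// ltW. Qed.

Lemma cost0 T : cost T 0 = 0.
Proof. by rewrite /cost/= normr0 powR0 ?lt0r_neq0// mulr0 addr0. Qed.

Lemma cost_gt0 T P : 0 < T -> P.2 != 0 -> 0 < cost T P.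
Proof.
by move=> T0 h; rewrite ltr_wpDl ?powR_ge0// mulr_gt0// powR_gt0// normr_gt0.
Qed.

Lemma powR_sum_scale t P : 0 < t ->
  `|t^-1 * P.1| `^ p + `|t * P.2| `^ p = (t `^ p)^-1 * cost (scale t) P.
Proof.
move=> t0; rewrite /cost; have tp : 0 < t `^ p by rewrite powR_gt0.
have -> : `|t^-1 * P.1| `^ p = (t `^ p)^-1 * `|P.1| `^ p.
  rewrite normrM powRM ?normr_ge0// gtr0_norm ?invr_gt0//; congr (_ * _).
  apply: (mulfI (lt0r_neq0 tp)); rewrite -powRM ?invr_ge0 ?ltW//.
  by rewrite !divff ?powR1 ?lt0r_neq0.
rewrite normrM powRM// gtr0_norm// /scale; field.
exact: lt0r_neq0.
Qed.

Lemma Lp_form_atE t P : 0 < t ->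
  Lp_form_at p t P = ((t `^ p)^-1 * cost (scale t) P) `^ p^-1.
Proof. by move=> t0; rewrite -powR_sum_scale. Qed.

Lemma Lp_form_at_lt t P Q : 0 < t ->
  (Lp_form_at p t P < Lp_form_at p t Q) = (cost (scale t) P < cost (scale t) Q).
Proof.
move=> t0; have tp : 0 < (t `^ p)^-1 by rewrite invr_gt0 powR_gt0.
have c0 S : 0 <= (t `^ p)^-1 * cost (scale t) S.
  by rewrite mulr_ge0 ?(ltW tp)// cost_ge0// scale_gt0.
by rewrite !Lp_form_atE// ltr_powR2 ?invr_gt0// ltr_pM2l.
Qed.

Lemma Lp_form_at_eq t P Q : 0 < t ->
  (Lp_form_at p t P == Lp_form_at p t Q) = (cost (scale t) P == cost (scale t) Q).
Proof.
move=> t0; rewrite !Lp_form_atE//.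
set a := cost _ P; set b := cost _ Q.
have tp : 0 < (t `^ p)^-1 by rewrite invr_gt0 powR_gt0.
have a0 : 0 <= a by rewrite cost_ge0// scale_gt0.
have b0 : 0 <= b by rewrite cost_ge0// scale_gt0.
clearbody a b.
rewrite eqr_powR2 ?invr_gt0 ?mulr_ge0 ?(ltW tp)//.
by rewrite (inj_eq (mulfI (lt0r_neq0 tp))).
Qed.

Definition minimal (T : R) (P : R * R) :=
  forall Q, L Q -> Q != 0 -> cost T P <= cost T Q.

Lemma admissibleP t P : 0 < t -> L P -> P != 0 ->
  admissible L (Lp_ball p t P) <-> minimal (scale t) P.
Proof.
move=> t0 LP P0; split => [adm Q LQ Q0|minP].
  rewrite leNgt -Lp_form_at_lt//; apply/negP => lt.
  have : [set 0] Q by rewrite -adm.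
  by move=> /= Q00; rewrite Q00 eqxx in Q0.
apply/seteqP; split => Q /=.
  move=> [LQ]; rewrite /Lp_ball/= Lp_form_at_lt// => lt.
  by apply/eqP; apply: contraTT lt => Q0; rewrite -leNgt minP.
move=> ->; split.
  by apply/lattice_ofP; exists 0, 0; rewrite /lpoint mul0r subr0.
rewrite /Lp_ball/= Lp_form_at_lt//.
rewrite {1}/cost/= normr0 powR0 ?lt0r_neq0// mulr0 addr0.
by rewrite cost_gt0 ?scale_gt0// lattice_snd_neq0.
Qed.

(** A difference of two costs is affine in [T], hence nonnegative between two times at which it is
    nonnegative. *)
Lemma minimal_between T1 T T2 P : T1 <= T -> T <= T2 ->
  minimal T1 P -> minimal T2 P -> minimal T P.
Proof.
move=> h1 h2 m1 m2 Q LQ Q0; have := m1 _ LQ Q0; have := m2 _ LQ Q0.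
rewrite /cost; set a := _ `^ p; set b := _ `^ p; set c := _ `^ p; set d := _ `^ p.
move=> k2 k1; have [bd|/ltW db] := leP b d.
  have : T1 * (d - b) <= T * (d - b) by rewrite ler_wpM2r// subr_ge0.
  lra.
have : T * (b - d) <= T2 * (b - d) by rewrite ler_wpM2r// subr_ge0.
lra.
Qed.

(** An affine function that is nonnegative at both ends and nonpositive at an interior time is
    identically zero, so slopes and constant terms agree. *)
Lemma minimal_unique T1 T T2 P Q : T1 < T -> T < T2 ->
  minimal T1 P -> minimal T2 P -> L Q -> Q != 0 -> cost T Q <= cost T P ->
  `|Q.1| = `|P.1| /\ `|Q.2| = `|P.2|.
Proof.
move=> h1 h2 m1 m2 LQ Q0; have := m1 _ LQ Q0; have := m2 _ LQ Q0.
rewrite /cost; set a := `|P.1| `^ p; set b := `|P.2| `^ p.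
set c := `|Q.1| `^ p; set d := `|Q.2| `^ p => k2 k1 k.
have bd : d = b.
  apply/eqP; rewrite eq_le; apply/andP; split.
  - rewrite leNgt; apply/negP => bd.
    have : T1 * (d - b) < T * (d - b) by rewrite ltr_pM2r// subr_gt0.
    lra.
  - rewrite leNgt; apply/negP => db.
    have : T * (b - d) < T2 * (b - d) by rewrite ltr_pM2r// subr_gt0.
    lra.
have ac : c = a by rewrite bd in k k1 k2; apply/eqP; rewrite eq_le; lra.
by split; apply/eqP; rewrite -(@eqr_powR2 _ p)//; apply/eqP.
Qed.

Definition leading (T : R) (P : R * R) :=
  forall Q, L Q -> cost T Q = cost T P -> Q.1 <= P.1.

(** The invariant of the algorithm at the start of each step; the initial point (0, 1) has
    x-coordinate 0, hence the weak inequality. *)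
Definition reduced (T : R) (P : R * R) :=
  [/\ L P, P != 0, 0 <= P.1, minimal T P & leading T P].

Lemma reduced_init : reduced 1 (0, 1).
Proof.
have L01 : L (0, 1).
  by apply/lattice_ofP; exists 0, 1; rewrite /lpoint mul0r subr0.
have c1 : cost 1 (0, 1) = 1.
  by rewrite /cost/= normr0 normr1 powR1 mul1r powR0 ?add0r// lt0r_neq0.
have int1 (s : int) : s != 0 -> 1 <= `|s%:~R : R| `^ p.
  by move=> s0; rewrite powR_ge1// -intr_norm ler1z -gtz0_ge1 normr_gt0.
have lt1 s r : s != 0 -> 1 < cost 1 (pt s r).
  move=> s0; rewrite /cost mul1r ltr_pwDr ?int1// powR_gt0// normr_gt0.
  by apply: contraNneq s0 => /lpoint_eq0[-> _].
split => //=.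
- by rewrite xpair_eqE oner_eq0 andbF.
- move=> Q /lattice_ofP[s [r ->]] Q0; rewrite c1.
  have [s0|/lt1/ltW//] := eqVneq s 0.
  rewrite /cost s0 mul1r ler_wpDl ?powR_ge0//= mul0r subr0 int1//.
  by apply: contraNneq Q0 => r0; rewrite s0 r0 /lpoint mul0r subr0.
- move=> Q /lattice_ofP[s [r ->]]; rewrite c1 => e.
  by have [->//|/(lt1 s r)] := eqVneq s 0; rewrite e ltxx.
Qed.

(** This finds the next edge of the lower convex hull. Only points with smaller |y| can overtake P
    as [T] grows; [ratio s] is the time at which the best point of denominator s does so, and T' is
    the least such time. *)
Lemma next_vertex T P : 0 < T -> reduced T P ->
  exists T' P', [/\ [/\ T < T', L P' & P.1 < P'.1], cost T' P' = cost T' P,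
    minimal T' P, leading T' P' & `|P'.2| < `|P.2|].
Proof.
move=> T0 [LP P0 P10 minP leadP].
have P20 : 0 < `|P.2| by rewrite normr_gt0 lattice_snd_neq0.
set X := `|P.1| `^ p; set Y := `|P.2| `^ p.
have Y0 : 0 < Y by rewrite powR_gt0.
have X0 : 0 <= X by exact: powR_ge0.
have nearest (s : nat) : {r : int |
    forall m : int, `|r%:~R - s%:~R * alpha| <= `|m%:~R - s%:~R * alpha|}.
  by apply: cid; exact: exists_nearest_int.
pose h (s : nat) := pt s (projT1 (nearest s)).
pose S : pred nat := [pred s | (0 < s)%N && (`|(h s).2| < `|P.2|)].
pose ratio (s : nat) := (`|(h s).1| `^ p - X) / (Y - `|(h s).2| `^ p).
have Sden s : S s -> 0 < Y - `|(h s).2| `^ p.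
  by case/andP => _ hs; rewrite subr_gt0 ltr_powR2.
have Lh s : L (h s) by exact: lpoint_in.
have h0 s : S s -> h s != 0.
  case/andP => s0 _; apply: contraTneq s0 => /(congr1 fst)/= /eqP.
  by rewrite intr_eq0 => /eqP[->].
(* Minimality gives the weak inequality. In case of a tie [leading] would bound the x-coordinate by
   [P.1], and with a smaller |y| the cost would be strictly smaller. *)
have Sgt s : S s -> T < ratio s.
  move=> Ss; rewrite ltr_pdivlMr ?Sden//.
  have := minP _ (Lh s) (h0 _ Ss); rewrite le_eqVlt => /orP[/eqP e|].
    have := leadP _ (Lh s) (esym e); rewrite -(ger0_norm P10) -[(h s).1]ger0_norm ?ler0z//.
    rewrite -(ler_powR2 p0)// -/X => le.
    move: e; rewrite /cost -/X -/Y => e; have := Sden _ Ss => ?; nra.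
  by rewrite /cost -/X -/Y; lra.
have exS : exists s, S s.
  have [s [r [s0 hr]]] := exists_lattice_near_axis P20.
  case: s s0 hr => // s s0 hr; exists s; rewrite /S/= (s0 : (0 < s)%N)/=.
  by apply: le_lt_trans hr; exact: (projT2 (nearest s)).
have bndS c : exists N, forall s, S s -> ratio s <= c -> (s <= N)%N.
  exists (Num.truncn ((X + c * Y) `^ p^-1)) => s Ss hs.
  have c0 : 0 < c by rewrite (lt_trans T0)// (lt_le_trans (Sgt _ Ss)).
  rewrite truncn_ge_nat ?powR_ge0//.
  have -> : s%:R = (s%:R `^ p) `^ p^-1 :> R.
    by rewrite -powRrM mulfV ?lt0r_neq0// powRr1.
  rewrite ler_powR2 ?invr_gt0 ?powR_ge0//; last by rewrite addr_ge0// mulr_ge0// ltW.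
  move: hs; rewrite ler_pdivrMr ?Sden// /= ger0_norm// => hs.
  have := powR_ge0 `|(h s).2| p; nra.
have [s [Ss mins maxs]] := exists_argmin_nat exS bndS.
set T' := ratio s in mins maxs; have TT' : T < T' by exact: Sgt.
(* Every competitor is, up to sign, no better than the nearest point [h s'] with the same |x|, so
   minimizing over denominators suffices. *)
have cmp (Q : R * R) : L Q -> Q != 0 -> `|Q.2| < `|P.2| ->
    exists2 s' : nat, S s' & `|Q.1| = (h s').1 /\ `|(h s').2| <= `|Q.2|.
  move=> + Q0 lt; wlog Q1 : Q Q0 lt / 0 <= Q.1.
    move=> W LQ; have [/W|/ltW lt0] := leP 0 Q.1; first exact.
    have := W (- Q); rewrite /= oppr_eq0 !normrN oppr_ge0; apply => //.
    exact: lattice_opp.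
  move=> LQ; move: (LQ) Q1 lt Q0 => /lattice_ofP[s1 [r1 ->]] /=; rewrite ler0z.
  case: s1 => // s1 _ lt Q0.
  have le : `|(h s1).2| <= `|r1%:~R - s1%:~R * alpha| by exact: (projT2 (nearest s1)).
  exists s1; last by split => //; rewrite ger0_norm.
  rewrite /S/= (le_lt_trans le lt) andbT lt0n; apply: contraTneq lt => s10.
  (* A nonzero point with x = 0 has |y| >= 1, while comparing P with (0, 1) gives |P.2| <= 1. *)
  rewrite s10 in Q0 *; rewrite mul0r subr0 -leNgt.
  have r0 : r1 != 0 by apply: contraNneq Q0 => ->; rewrite /lpoint mul0r subr0.
  have := minP (0, 1); have [L01 n01 _ _ _] := reduced_init => /(_ L01 n01).
  rewrite {2}/cost/= normr0 normr1 powR1 powR0 ?lt0r_neq0// add0r mulr1.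
  rewrite /cost -/X -/Y => hT.
  have : Y <= 1 by rewrite -(ler_pM2l T0); lra.
  rewrite powR_le1// => /le_trans; apply.
  by rewrite -intr_norm ler1z -gtz0_ge1 normr_gt0.
have T'0 : 0 < T' by exact: lt_trans TT'.
have hsE : T' * (Y - `|(h s).2| `^ p) = `|(h s).1| `^ p - X.
  by rewrite divfK// lt0r_neq0// Sden.
have Plt : P.1 < (h s).1.
  rewrite -[P.1]ger0_norm// -[(h s).1]ger0_norm ?ler0z// -(ltr_powR2 p0)//.
  by rewrite -subr_gt0 -hsE mulr_gt0// Sden.
have costE : cost T' (h s) = cost T' P by rewrite /cost -/X -/Y; lra.
exists T', (h s); split => //.
- move=> Q LQ Q0; have [lt|ge] := ltP `|Q.2| `|P.2|.
    have [s' Ss' [e1 le2]] := cmp _ LQ Q0 lt.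
    have := mins _ Ss'; rewrite ler_pdivlMr ?Sden// -e1 normr_id => k.
    move: le2; rewrite -(ler_powR2 p0)// -(ler_pM2l T'0) => le2.
    rewrite /cost -/X -/Y; lra.
  have := minP _ LQ Q0; rewrite -(ler_powR2 p0)// -/Y -subr_ge0 in ge.
  have : T * (`|Q.2| `^ p - Y) <= T' * (`|Q.2| `^ p - Y) by rewrite ler_wpM2r// ltW.
  by rewrite /cost -/X -/Y; lra.
- move=> Q LQ; rewrite costE => e.
  have Q0 : Q != 0.
    apply: contra_eqN e => /eqP ->; rewrite cost0 lt_eqF//.
    by rewrite cost_gt0// lattice_snd_neq0.
  have [lt|ge] := ltP `|Q.2| `|P.2|.
    have [s' Ss' [e1 le2]] := cmp _ LQ Q0 lt.
    apply: le_trans (ler_norm _) _; rewrite e1 ler_int lez_nat; apply: maxs => //.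
    suff le1 : ratio s' <= T' by apply: le_anti; rewrite le1 mins.
    rewrite ler_pdivrMr ?Sden// -e1 normr_id.
    move: le2; rewrite -(ler_powR2 p0)// -(ler_pM2l T'0).
    by move: e; rewrite /cost -/X -/Y; lra.
  apply: le_trans (ler_norm _) _; apply: le_trans (ltW Plt).
  rewrite -[P.1]ger0_norm// -(ler_powR2 p0)// -/X.
  move: ge; rewrite -(ler_powR2 p0)// -/Y -(ler_pM2l T'0).
  by move: e; rewrite /cost -/X -/Y; lra.
- by have /andP[] := Ss.
Qed.

(** The time of the next vertex is the largest admissible one: P' has the smaller slope, so right
    after the tie it is cheaper than P. *)
Lemma reduced_scale_step t P : 0 < t -> reduced (scale t) P ->
  exists t' P', [/\ t < t', P.1 < P'.1 & pcf_step p alpha t P t' P'].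
Proof.
move=> t0 red; have [LP P0 P10 minP leadP] := red.
have T0 := scale_gt0 t0.
have [T' [P' [[TT' LP' lt1] costE minP' leadP' lt2]]] := next_vertex T0 red.
have [t' t'0 t'E] := scale_surj (lt_trans T0 TT').
rewrite -{}t'E in TT' costE minP' leadP'.
rewrite ltr_scale// in TT'.
exists t', P'; split; [exact: TT'|exact: lt1|split => /=].
- split.
    split; first exact: ltW.
    move=> u /andP[tu ut']; have u0 : 0 < u by exact: lt_le_trans tu.
    apply/admissibleP => //; apply: minimal_between minP minP'; by rewrite ler_scale.
  move=> u [tu]; rewrite leNgt => adm; apply/negP => t'u.
  have u0 : 0 < u by exact: lt_le_trans tu.
  have /admissibleP -/(_ u0 LP P0) : admissible L (Lp_ball p u P).
    by apply: adm; rewrite tu lexx.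
  move/(_ P' LP'); have P'0 : P' != 0.
    by apply: contraTneq lt1 => ->; rewrite -leNgt.
  move=> /(_ P'0); rewrite leNgt; apply/negP; rewrite negbK.
  have : scale t' < scale u by rewrite ltr_scale.
  rewrite -(ltr_powR2 p0) ?normr_ge0// in lt2 => tu'.
  have : scale t' * (`|P.2| `^ p - `|P'.2| `^ p) <
         scale u * (`|P.2| `^ p - `|P'.2| `^ p) by rewrite ltr_pM2r// subr_gt0.
  by move: costE; rewrite /cost; lra.
- split; first by split; [exact: LP'|apply/eqP; rewrite Lp_form_at_eq// costE].
  move=> Q [LQ /eqP]; rewrite Lp_form_at_eq// => /eqP e.
  by apply: leadP'; rewrite ?costE.
Qed.

(** The largest admissible time is unique, so an arbitrary step shares its time with the constructed
    one, and its point reaches at least as far in x. *)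
Lemma pcf_step_reduced t P t' P' : 0 < t -> reduced (scale t) P ->
  pcf_step p alpha t P t' P' ->
  [/\ t < t', P.1 < P'.1, reduced (scale t') P', minimal (scale t') P
    & cost (scale t') P' = cost (scale t') P].
Proof.
move=> t0 red [/= [[tt' adm] ub] [[LP' /eqP e] maxP']].
have [LP P0 P10 minP leadP] := red.
have [u [Q [tu PQ [/= [A1 ub1] [[LQ eQ] maxQ]]]]] := reduced_scale_step t0 red.
have t'0 : 0 < t' by exact: lt_le_trans tt'.
have ut' : u = t'.
  apply/le_anti/andP; split; first exact: (ub _ A1).
  by apply: ub1; split; [exact: tt'|exact: adm].
subst u.
have lt1 : P.1 < P'.1 := lt_le_trans PQ (maxP' Q (conj LQ eQ)).
clear eQ maxQ; move: e; rewrite Lp_form_at_eq; last exact: t'0.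
move/eqP => e.
have minP' : minimal (scale t') P.
  by apply/(admissibleP t'0 LP P0); apply: adm; rewrite tt' lexx.
split; [exact: tu|exact: lt1|split|exact: minP'|exact: e].
- exact: LP'.
- by apply: contraTneq lt1 => ->; rewrite -leNgt.
- by apply: le_trans P10 (ltW lt1).
- by move=> S LS S0; rewrite e; exact: minP'.
- move=> S LS eS; apply: maxP'; split; first exact: LS.
  by apply/eqP; rewrite Lp_form_at_eq; [rewrite eS e|exact: t'0].
Qed.

End lattice.

(** * Continued fractions from determinants *)

Definition wedge (K : pzRingType) (x y : nat -> K) (i j : nat) := x i * y j - y i * x j.

Section cfrac.
Variables x y d a e : nat -> rat.
Local Notation W := (wedge x y).
Hypothesis W_neq0 : forall i j, i != j -> W i j != 0.
Hypothesis d_neq0 : forall k, d k != 0.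
Hypothesis aE : forall k, a k.+1 * d k.+1 = W k.+2 k.
Hypothesis eE : forall k,
  e k.+2 * (d k.+1 * d k.+2) = - (W k.+1 k * W k.+3 k.+2).

(** Here [d] holds the divided-out factors: dividing a_n, e_n and e_{n+1} by d_n divides the tail
    starting at n by d_n and leaves the fraction unchanged. The start [k] is general because [cfrac]
    unfolds from the left. *)
Lemma cfrac_tail n k : cfrac a e k.+1 n =
  W (k + n).+2 k * W k.+2 k.+1 / (W (k + n).+2 k.+1 * d k.+1).
Proof.
have aE' m : a m.+1 = W m.+2 m / d m.+1 by rewrite -aE mulfK.
have eE' m : e m.+2 = - (W m.+1 m * W m.+3 m.+2) / (d m.+1 * d m.+2).
  by rewrite -eE mulfK// mulf_neq0.
have ne i j : i != j -> x i * y j - y i * x j != 0 by exact: W_neq0.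
elim: n k => [|n IH] k /=.
  rewrite addn0 aE' invfM mulrA mulfK// W_neq0//.
  by rewrite gtn_eqF.
rewrite IH aE' eE' addSnnS.
have h1 : x (k + n.+1).+2 * y k.+2 - y (k + n.+1).+2 * x k.+2 != 0.
  by apply: ne; rewrite gtn_eqF// !ltnS addnS ltnS leq_addr.
have h2 : x (k + n.+1).+2 * y k.+1 - y (k + n.+1).+2 * x k.+1 != 0.
  by apply: ne; rewrite gtn_eqF// !ltnS leq_addr.
have h3 : x k.+3 * y k.+2 - y k.+3 * x k.+2 != 0 by apply: ne; rewrite gtn_eqF.
(* This is the three-term Plucker relation for the determinants W. *)
rewrite /wedge; field.
by rewrite h1 h2 h3 !d_neq0.
Qed.

Hypothesis x0 : x 0%N = 0.
Hypothesis y0 : y 0%N = x 1%N.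
Hypothesis a0 : a 0%N = y 1%N / x 1%N.
Hypothesis e1 : e 1%N * d 1%N = - W 2 1.
Hypothesis x_neq0 : forall n, x n.+1 != 0.

Lemma cfrac_convergent n : cfrac a e 0 n = y n.+1 / x n.+1.
Proof.
case: n => [//|n /=].
have -> : e 1%N = - W 2 1 / d 1%N by rewrite -e1 mulfK.
rewrite cfrac_tail a0 add0n.
have h1 : x n.+2 * y 1%N - y n.+2 * x 1%N != 0 by exact: W_neq0.
have h2 : x 2%N * y 1%N - y 2%N * x 1%N != 0 by exact: W_neq0.
rewrite /wedge x0 y0 mulr0 subr0; field.
by rewrite h1 h2 !x_neq0 !d_neq0.
Qed.

End cfrac.

(** * Successive division by common divisors *)

Section gcd_steps.
Variables a e : nat -> int.
Hypothesis e_neq0 : forall n, e n.+1 != 0.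
Local Notation St n := (gcd_steps n (a, e)).

(** The divisor used by step n. The value 1 at 0 lets each e_n, n >= 1, be divided uniformly by the
    divisors of steps n - 1 and n. *)
Definition gcd_div n : int :=
  if n is k.+1 then gcdz (gcdz ((St k).2 n) ((St k).1 n)) ((St k).2 n.+1) else 1.

Lemma gcd_steps_untouched n k : (n < k)%N ->
  (St n).1 k = a k /\ (St n).2 k.+1 = e k.+1.
Proof.
elim: n => [//|n IH] nk; have [IH1 IH2] := IH (ltnW nk).
by rewrite /= !gtn_eqF//=; apply: leqW.
Qed.

Lemma gcd_steps_next n : (St n).2 n.+1 * gcd_div n = e n.+1.
Proof.
case: n => [|n]; first by rewrite mulr1.
rewrite /= eqxx orbT divzK ?dvdz_gcdr//.
by have [] := gcd_steps_untouched (ltnSn n).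
Qed.

Lemma gcd_div_neq0 n : gcd_div n != 0.
Proof.
case: n => [//|n]; rewrite /gcd_div !gcdz_eq0.
have := e_neq0 n; rewrite -gcd_steps_next.
by rewrite mulf_eq0 negb_or => /andP[/negbTE ->].
Qed.

Lemma gcd_steps_fst n : (St n.+1).1 n.+1 * gcd_div n.+1 = a n.+1.
Proof.
rewrite /= eqxx divzK; last by rewrite (dvdz_trans (dvdz_gcdl _ _))// dvdz_gcdr.
by have [] := gcd_steps_untouched (ltnSn n).
Qed.

Lemma gcd_steps_snd n : (St n.+1).2 n.+1 * gcd_div n.+1 = (St n).2 n.+1.
Proof.
by rewrite /= eqxx divzK// (dvdz_trans (dvdz_gcdl _ _))// dvdz_gcdl.
Qed.

(** The gcd is 1 right after step n + 1, and the following step only replaces e_{n+2} by one of its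
    divisors. *)
Lemma gcd_steps_coprime n :
  gcdz (gcdz ((St n.+1).2 n.+1) ((St n.+1).1 n.+1)) ((St n.+2).2 n.+2) = 1.
Proof.
have c1 : gcdz (gcdz ((St n.+1).2 n.+1) ((St n.+1).1 n.+1)) ((St n.+1).2 n.+2) = 1.
  have := gcd_div_neq0 n.+1; set D := gcd_div n.+1 => D0.
  have D1 : D = gcdz (gcdz ((St n.+1).2 n.+1 * D) ((St n.+1).1 n.+1 * D))
                     ((St n.+1).2 n.+2 * D).
    rewrite gcd_steps_snd gcd_steps_fst gcd_steps_next.
    rewrite {1}/D /gcd_div.
    by have [-> ->] := gcd_steps_untouched (ltnSn n).
  have Dp : `|D|%N = D :> int by rewrite /D /gcd_div.
  rewrite -mulz_gcdl Dp -mulz_gcdl Dp -{1}[D]mul1r in D1.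
  by have /esym := mulIf D0 D1.
set g := gcdz _ _.
have g_dvd : (g %| gcdz (gcdz ((St n.+1).2 n.+1) ((St n.+1).1 n.+1))
    ((St n.+1).2 n.+2))%Z.
  by rewrite dvdz_gcd dvdz_gcdl andTb -(gcd_steps_snd n.+1) dvdz_mulr// dvdz_gcdr.
rewrite c1 in g_dvd.
by have /eqP g1 := etrans (esym (dvdz1 g)) g_dvd; congr Posz.
Qed.

End gcd_steps.

(** * Sequences of convergents *)

Section sequence.
Variables (R : realType) (alpha p : R).
Hypotheses (irr : irrational alpha) (p0 : 0 < p).

Lemma exists_pcf_points : exists (t : nat -> R) (P : nat -> R * R),
  pcf_step p alpha 1 (0, 1) (t 0%N) (P 0%N) /\
  forall m, pcf_step p alpha (t m) (P m) (t m.+1) (P m.+1).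
Proof.
pose state := {u : R * (R * R) | 0 < u.1 /\ reduced alpha p (scale p u.1) u.2}.
have next (u : state) : {v : state |
    pcf_step p alpha (sval u).1 (sval u).2 (sval v).1 (sval v).2}.
  apply: cid; case: u => -[t P] /= [t0 red].
  have [t' [P' [tt' _ step]]] := reduced_scale_step irr p0 t0 red.
  have [_ _ red' _ _] := pcf_step_reduced irr p0 t0 red step.
  by exists (exist _ (t', P') (conj (lt_trans t0 tt') red')).
have init : 0 < (1 : R) /\ reduced alpha p (scale p 1) (0, 1).
  by rewrite scale1; split=> //; exact: reduced_init.
pose st n := iter n (fun u => sval (next u)) (exist _ (1, (0, 1)) init : state).
(* State 0 is the initial pair of index -1, hence the shift. *)
exists (fun n => (sval (st n.+1)).1), (fun n => (sval (st n.+1)).2).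
by split=> [|m]; [exact: (svalP (next (st 0%N)))|exact: (svalP (next (st m.+1)))].
Qed.

Lemma rat_point_lattice q : lattice_of alpha (rat_point alpha q).
Proof. exact: lpoint_in. Qed.

Lemma rat_point_neq0 q : rat_point alpha q != 0.
Proof. by rewrite xpair_eqE intr_eq0 negb_and denq_neq0. Qed.

(** Equal denominators and opposite second coordinates would make alpha rational. *)
Lemma rat_point_abs_inj q q' :
  `|(rat_point alpha q).1| = `|(rat_point alpha q').1| ->
  `|(rat_point alpha q).2| = `|(rat_point alpha q').2| -> q = q'.
Proof.
have dR (x : rat) : `|(denq x)%:~R| = (denq x)%:~R :> R.
  by rewrite ger0_norm// ler0z denq_ge0.
rewrite /rat_point/= !dR => /intr_inj dE.
rewrite dE => /eqP; rewrite eqr_norm2 => /orP[/eqP /addIr /intr_inj nE|/eqP e].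
  by rewrite -[q]divq_num_den -[q']divq_num_den dE nE.
have : (numq q + numq q')%:~R = (denq q' * 2)%:~R * alpha.
  by rewrite intrD intrM; move: e; lra.
move/(int_irrational irr) => [/eqP]; rewrite mulf_eq0 orbF => /eqP h.
by have := denq_gt0 q'; rewrite h.
Qed.

(** A minimal point is primitive: a proper multiple by k costs k^p times as much. Hence the
    coordinates of convergents are in lowest terms. *)
Lemma minimal_rat_point T (s r : int) : 0 < T -> 0 < s ->
  minimal alpha p T (lpoint alpha s r) ->
  lpoint alpha s r = rat_point alpha (r%:~R / s%:~R).
Proof.
move=> T0 s0; set q := _ / _.
have [k [k0 sE rE]] := fraction_multiple s0 (erefl q).
have [a [b [qE b0 Ek]]] : exists a b, [/\ rat_point alpha q = (a, b), b != 0
    & lpoint alpha s r = (k%:~R * a, k%:~R * b)].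
  exists (rat_point alpha q).1, (rat_point alpha q).2.
  split; first exact: surjective_pairing.
    exact: (lattice_snd_neq0 irr (rat_point_lattice q) (rat_point_neq0 q)).
  by rewrite /lpoint /rat_point sE rE !intrM/=; congr pair; ring.
move=> /(_ _ (rat_point_lattice q) (rat_point_neq0 q)); rewrite Ek qE.
have q2 : 0 < `|b| `^ p by rewrite powR_gt0// normr_gt0.
have q1 := powR_ge0 `|a| p.
rewrite /cost/= !normrM !powRM// => le.
suff -> : k = 1 by rewrite !(mulr1z, mul1r).
apply/eqP; rewrite eq_le -gtz0_ge1 k0 andbT -(lerz1 R).
rewrite -[k%:~R]ger0_norm ?ler0z ?(ltW k0)// -(@powR_le1 _ p)//.
rewrite leNgt; apply/negP => k1; move: le; apply/negP; rewrite -ltNge.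
set K := `|k%:~R| `^ p in k1 *.
apply: ler_ltD; first by rewrite ler_peMl// ltW.
by rewrite ltr_pM2l// ltr_pMl.
Qed.

Variables (t : nat -> R) (P : nat -> R * R) (s r : nat -> int).
Hypothesis step0 : pcf_step p alpha 1 (0, 1) (t 0%N) (P 0%N).
Hypothesis stepS : forall m, pcf_step p alpha (t m) (P m) (t m.+1) (P m.+1).
Hypothesis sE : forall m, (s m)%:~R = (P m).1.
Hypothesis rE : forall m, (r m)%:~R = (P m).2 + (P m).1 * alpha.

Lemma pcf_reduced0 : [/\ 1 < t 0%N, 0 < (P 0%N).1,
  reduced alpha p (scale p (t 0%N)) (P 0%N) & minimal alpha p (scale p (t 0%N)) (0, 1)].
Proof.
have red : reduced alpha p (scale p 1) (0, 1) by rewrite scale1; exact: reduced_init.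
by have [] := pcf_step_reduced irr p0 ltr01 red step0.
Qed.

Lemma pcf_reduced m : [/\ 1 < t m, 0 < (P m).1 & reduced alpha p (scale p (t m)) (P m)].
Proof.
elim: m => [|m [t1 P1 red]]; first by have [] := pcf_reduced0.
have [h1 h2 h3 _ _] := pcf_step_reduced irr p0 (lt_trans ltr01 t1) red (stepS m).
by split; [exact: lt_trans h1|exact: lt_trans h2|].
Qed.

Lemma pcf_t_gt1 m : 1 < t m. Proof. by have [] := pcf_reduced m. Qed.

Lemma pcf_t_gt0 m : 0 < t m. Proof. exact: lt_trans (pcf_t_gt1 m). Qed.

Lemma pcf_min m : minimal alpha p (scale p (t m)) (P m).
Proof. by have [_ _ []] := pcf_reduced m. Qed.

Lemma pcf_step_facts m : [/\ t m < t m.+1, (P m).1 < (P m.+1).1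
  & minimal alpha p (scale p (t m.+1)) (P m)].
Proof.
have [t1 _ red] := pcf_reduced m.
by have [] := pcf_step_reduced irr p0 (pcf_t_gt0 m) red (stepS m).
Qed.

Lemma pcf_pointE m : P m = lpoint alpha (s m) (r m).
Proof. by rewrite /lpoint sE rE addrK -surjective_pairing. Qed.

Lemma pcf_s_gt0 m : 0 < s m.
Proof. by rewrite -(ltr0z R) sE; have [] := pcf_reduced m. Qed.

Lemma pcf_s_lt m : s m < s m.+1.
Proof. by rewrite -(ltr_int R) !sE; have [] := pcf_step_facts m. Qed.

Lemma pcf_s_mono i j : (i < j)%N -> s i < s j.
Proof. by move=> ij; apply: (homo_ltn (@lt_trans _ _) pcf_s_lt). Qed.

Lemma pcf_s_ge m : m%:Z < s m.
Proof.
elim: m => [|m IH]; first exact: pcf_s_gt0.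
by have := pcf_s_lt m; move: IH; rewrite -!lezD1 => h1 h2; rewrite -natz -natr1 natz; lra.
Qed.

Local Notation conv m := ((r m)%:~R / (s m)%:~R : rat).

Lemma pcf_point_rat m : P m = rat_point alpha (conv m).
Proof.
rewrite pcf_pointE; apply: (@minimal_rat_point (scale p (t m))).
- exact: scale_gt0 (pcf_t_gt0 m).
- exact: pcf_s_gt0.
- by rewrite -pcf_pointE; exact: pcf_min.
Qed.

Lemma conv_inj : injective (fun m => conv m).
Proof.
move=> i j e; have : s i = s j.
  by apply: (@intr_inj R); rewrite !sE !pcf_point_rat e.
by case: (ltngtP i j) => // /pcf_s_mono; [move=> + h|move=> + h]; rewrite h ltxx.
Qed.

Lemma conv_best_approx n : Lp_best_approx p alpha (conv n).
Proof.
have [tt' _ min'] := pcf_step_facts n.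
have t1 := pcf_t_gt1 n.
(* The time must be interior: at [t n.+1] the next point ties with [P n]. *)
pose u := (t n + t n.+1) / 2.
have tu : t n < u by rewrite /u; lra.
have ut' : u < t n.+1 by rewrite /u; lra.
have u0 : 0 < u by lra.
have strict Q : lattice_of alpha Q -> Q != 0 ->
    (`|Q.1| = `|(P n).1| -> `|Q.2| = `|(P n).2| -> False) ->
    Lp_form_at p u (rat_point alpha (conv n)) < Lp_form_at p u Q.
  move=> LQ Q0 ne; rewrite -pcf_point_rat Lp_form_at_lt// ltNge; apply/negP => le.
  have [] := @minimal_unique _ alpha p p0 (scale p (t n)) (scale p u)
    (scale p (t n.+1)) (P n) Q => //.
  - by rewrite ltr_scale// pcf_t_gt0.
  - by rewrite ltr_scale// pcf_t_gt0.
  - exact: pcf_min.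
exists u; split; first by lra.
- move=> q' q'n; apply: strict; [exact: rat_point_lattice|exact: rat_point_neq0|].
  rewrite pcf_point_rat => e1 e2; move: q'n.
  by rewrite (rat_point_abs_inj e1 e2) eqxx.
- have [L01 n01 _ _ _] := @reduced_init _ _ irr p p0.
  apply: strict => //= /eqP; rewrite normr0 eq_sym normr_eq0.
  by rewrite -sE intr_eq0 gt_eqF// pcf_s_gt0.
Qed.

(** Before [t 0] the point (0, 1) is minimal, so the competitor 1/0 rules out such times. Any later
    u lies between some [t m] and [t m.+1], where minimality of [P m] contradicts a strict win of
    another rational. *)
Lemma best_approx_conv q : (forall u, exists n, u < t n) ->
  Lp_best_approx p alpha q -> exists n, q = conv n.
Proof.
move=> unb [u [u1 best best01]]; have u0 : 0 < u := lt_trans ltr01 u1.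
have [red0 _ _ min01] := pcf_reduced0.
have Lq := rat_point_lattice q; have nq := rat_point_neq0 q.
have u_ge : t 0%N <= u.
  rewrite leNgt; apply/negP => ut; move: best01; rewrite Lp_form_at_lt//.
  apply/negP; rewrite -leNgt.
  have min1 : minimal alpha p (scale p 1) (0, 1).
    by rewrite scale1; have [] := @reduced_init _ _ irr p p0.
  apply: (minimal_between _ _ min1 min01) => //.
    by rewrite ler_scale// ltW.
  by rewrite ler_scale ?pcf_t_gt0// ltW.
have [m [h1 h2]] : exists m, t m <= u /\ u <= t m.+1.
  have [n] := unb u; elim: n => [|n IH] h; first by move: u_ge; rewrite leNgt h.
  have [/IH//|le] := ltP u (t n); exists n; split => //; exact: ltW.
exists m; apply/eqP; apply: contraT => /negP ne.
have /best : conv m != q by apply/negP => /eqP e; apply: ne; rewrite e.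
rewrite Lp_form_at_lt// -pcf_point_rat ltNge => /negP[].
have [_ _ minm] := pcf_step_facts m.
apply: (minimal_between _ _ (@pcf_min m) minm) => //.
  by rewrite ler_scale// pcf_t_gt0.
by rewrite ler_scale// pcf_t_gt0.
Qed.


(* Indices are shifted by one: index 0 is the second row (0, x_0) of g_0, so that
   W m.+1 m is det g_m for every m. *)
Definition ext_s n : int := if n is m.+1 then s m else 0.
Definition ext_r n : int := if n is m.+1 then r m else s 0%N.
Definition ext_P n : R * R := if n is m.+1 then P m else (0, (P 0%N).1).
Local Notation W := (wedge ext_s ext_r).

Lemma wedgeE i j : (W i j)%:~R = (ext_P i).1 * (ext_P j).2 - (ext_P i).2 * (ext_P j).1.
Proof.
rewrite /wedge intrB !intrM; case: i j => [|i] [|j]; rewrite /= ?sE ?rE; ring.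
Qed.

Lemma wedge_neq0 i j : i != j -> W i j != 0.
Proof.
wlog ij : i j / (j < i)%N.
  move=> H ne; have [lt|lt|e] := ltngtP i j.
  - have := H j i lt; rewrite eq_sym => /(_ ne).
    rewrite /wedge => h; rewrite -oppr_eq0 opprB.
    by rewrite mulrC [X in _ - X]mulrC.
  - exact: H.
  - by rewrite e eqxx in ne.
move=> _; case: i ij => // i; case: j => [_|j ij]; rewrite /wedge/=.
  by rewrite mulr0 subr0 mulf_neq0// gt_eqF// pcf_s_gt0.
apply/eqP => /eqP; rewrite subr_eq0 => /eqP e.
suff /conv_inj ji : conv j = conv i by rewrite ji ltnn in ij.
have si : (s i)%:~R != 0 :> rat by rewrite intr_eq0 gt_eqF// pcf_s_gt0.
have sj : (s j)%:~R != 0 :> rat by rewrite intr_eq0 gt_eqF// pcf_s_gt0.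
by apply/eqP; rewrite eqr_div// -!intrM mulrC e.
Qed.

(** * Bounds on minimal points and their determinants *)

Section bounds.
Variables (c d : R).
Hypotheses (c0 : 0 < c) (c5 : 5 * c ^+ 2 = 1) (d0 : 0 < d).
Hypothesis bound_p : forall x y : R, 0 <= x <= 7 -> 0 <= y <= 7 -> x * y <= c ->
  (x `^ p + y `^ p) ^+ 2 < 4 * (c + d) `^ p.

Lemma minimal_powR_sum_lt u Q : 1 <= u -> minimal alpha p (scale p u) Q ->
  (`|u^-1 * Q.1| `^ p + `|u * Q.2| `^ p) ^+ 2 < 4 * (c + d) `^ p.
Proof.
move=> u1 minQ; have u0 : 0 < u by lra.
have [m [n [mn h1 h2 h3]]] := small_lattice_point alpha u1 c0 c5.
have := minQ _ (lpoint_in alpha m n); have -> : lpoint alpha m n != 0.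
  apply: contraTneq mn => e; have /(lpoint_eq0 irr)[-> ->] // : (lpoint alpha m n).2 = 0.
  by rewrite e.
have up : 0 < (u `^ p)^-1 by rewrite invr_gt0 powR_gt0.
move=> /(_ isT); rewrite -(ler_pM2l up) -!powR_sum_scale// => le.
apply: le_lt_trans (bound_p (x := `|u^-1 * m%:~R|) (y := `|u * (n%:~R - m%:~R * alpha)|) _ _ _).
- by rewrite ler_sqr ?nnegrE ?addr_ge0 ?powR_ge0.
- by rewrite normr_ge0.
- by rewrite normr_ge0.
- by rewrite -normrM mulrACA mulVf ?mul1r// gt_eqF.
Qed.

Lemma minimal_mul_lt u Q : 1 <= u -> minimal alpha p (scale p u) Q ->
  `|Q.1 * Q.2| < c + d.
Proof.
move=> u1 minQ; have u0 : 0 < u by lra.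
have lt := minimal_powR_sum_lt u1 minQ.
have -> : Q.1 * Q.2 = (u^-1 * Q.1) * (u * Q.2).
  by rewrite mulrACA mulVf ?mul1r// gt_eqF.
have cd0 : 0 <= c + d by exact: addr_ge0 (ltW c0) (ltW d0).
rewrite normrM -(ltr_powR2 p0) ?mulr_ge0// powRM//.
move: lt; set x := _ `^ p; set y := _ `^ p => lt.
have := sqr_ge0 (x - y); nra.
Qed.

(** If a sum z of p-th powers satisfies z^2 < 4 (c + d)^p, then z <= 1 + z^2 bounds each summand. *)
Definition coord_bound : R := (1 + 4 * (c + d) `^ p) `^ p^-1.

Lemma minimal_coord_le u Q : 1 <= u -> minimal alpha p (scale p u) Q ->
  `|u^-1 * Q.1| <= coord_bound /\ `|u * Q.2| <= coord_bound.
Proof.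
move=> u1 /(minimal_powR_sum_lt u1).
have x0 := powR_ge0 `|u^-1 * Q.1| p; have y0 := powR_ge0 `|u * Q.2| p.
have K0 : 0 <= (c + d) `^ p by exact: powR_ge0.
have E (z : R) : `|z| = (`|z| `^ p) `^ p^-1.
  by rewrite -powRrM mulfV ?lt0r_neq0// powRr1.
move=> lt; split; rewrite /coord_bound [leLHS]E ler_powR2 ?invr_gt0 ?powR_ge0//; nra.
Qed.

Lemma coord_bound_ge0 : 0 <= coord_bound. Proof. exact: powR_ge0. Qed.

(** The x-coordinate of [P n] exceeds n, yet is at most [coord_bound] times [t n]. *)
Lemma pcf_t_unbounded u : exists n, u < t n.
Proof.
have B0 := coord_bound_ge0.
exists (Num.truncn (`|u| * coord_bound)).+1; set n := _.+1.
have [h _] := minimal_coord_le (ltW (pcf_t_gt1 n)) (@pcf_min n).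
have t0 := pcf_t_gt0 n.
rewrite normrM gtr0_norm ?invr_gt0// mulrC ler_pdivrMr// in h.
have := truncnS_gt (`|u| * coord_bound); rewrite -/n => lt.
have : n%:R < (P n).1 by rewrite -sE -[n%:R]/(n%:Z%:~R) ltr_int pcf_s_ge.
move=> lt2; have {}h := le_trans (ler_norm _) h.
rewrite (le_lt_trans (ler_norm u))// ltNge; apply/negP => le.
have : coord_bound * t n <= coord_bound * `|u| by rewrite ler_wpM2l.
lra.
Qed.

(** The quadratic term serves determinants of consecutive points, the quartic one the matrix g_0,
    and the 1 makes the bound at most its own square. *)
Definition wedge_bound : R := 1 + 2 * coord_bound ^+ 2 + coord_bound ^+ 4.

Lemma wedge_le m : `|(W m.+1 m)%:~R : R| <= wedge_bound.
Proof.
have B0 := coord_bound_ge0; rewrite /wedge_bound; set B := coord_bound in B0 *.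
have B2 : 0 <= B ^+ 2 by exact: sqr_ge0.
have B4 : 0 <= B ^+ 4 by exact: exprn_ge0.
rewrite wedgeE; case: m => [|m].
  rewrite mulr0 subr0 normrM /=.
  (* Since (0, 1) is still minimal at time [t 0], that time is at most B; so x_0 <= B t_0 <= B^2,
     and det g_0 = x_0^2. *)
  have [t1 s0 _ min01] := pcf_reduced0; have t0 := pcf_t_gt0 0.
  have [_ /=] := minimal_coord_le (ltW t1) min01.
  rewrite mulr1 gtr0_norm// -/B => tB.
  have [] := minimal_coord_le (ltW t1) (@pcf_min 0).
  rewrite normrM gtr0_norm ?invr_gt0// mulrC ler_pdivrMr// -/B => xB _.
  have xB2 : `|(P 0%N).1| <= B ^+ 2 by rewrite (le_trans xB)// expr2 ler_wpM2l.
  have : `|(P 0%N).1| * `|(P 0%N).1| <= B ^+ 2 * B ^+ 2 by rewrite ler_pM.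
  by rewrite -exprD; lra.
have [_ _ minm] := pcf_step_facts m.
have t0 := pcf_t_gt0 m.+1.
have [a1 a2] := minimal_coord_le (ltW (pcf_t_gt1 m.+1)) minm.
have [b1 b2] := minimal_coord_le (ltW (pcf_t_gt1 m.+1)) (@pcf_min m.+1).
move: a1 a2 b1 b2; rewrite /= -/B; set u := t m.+1 in t0 *.
(* Both points are minimal at the common time u, and rescaling by (1/u, u) preserves the
   determinant. *)
have -> : (P m.+1).1 * (P m).2 - (P m.+1).2 * (P m).1 =
    (u^-1 * (P m.+1).1) * (u * (P m).2) - (u * (P m.+1).2) * (u^-1 * (P m).1).
  by field; rewrite gt_eqF.
move=> a1 a2 b1 b2; rewrite (le_trans (ler_normB _ _))// !normrM.
have h1 := ler_pM (normr_ge0 _) (normr_ge0 _) b1 a2.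
have h2 := ler_pM (normr_ge0 _) (normr_ge0 _) b2 a1.
by move: h1 h2; rewrite !normrM -expr2; lra.
Qed.

End bounds.

End sequence.

(** * Two-by-two matrices and existence of the expansion *)

Lemma det_mx22 (R : realType) (a b c d : R) : \det (mx22 a b c d) = a * d - b * c.
Proof.
rewrite (expand_det_row _ ord0) !big_ord_recl big_ord0 /cofactor !det_mx11 !mxE /=.
by rewrite addr0 !expr0 expr1; ring.
Qed.

Lemma mul_mx22 (R : realType) (u v x1 y1 x0 y0 : R) :
  mx22 u v 1 0 *m mx22 x1 y1 x0 y0 = mx22 (u * x1 + v * x0) (u * y1 + v * y0) x1 y1.
Proof.
apply/matrixP => i j; rewrite !mxE !big_ord_recl big_ord0 !mxE /=.
by case: i j => [[|[|]]] //= ? [[|[|]]] //= ?; rewrite ?(mul1r, mul0r, addr0).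
Qed.

Lemma mx22_inj (R : realType) (a b c d a' b' c' d' : R) :
  mx22 a b c d = mx22 a' b' c' d' -> a = a' /\ b = b'.
Proof.
move=> /matrixP e; have := e 0 0; have := e 0 1; rewrite !mxE /=.
by [].
Qed.

Lemma pcf_mx_ext (R : realType) (P : nat -> R * R) m :
  pcf_mx P m = mx22 (ext_P P m.+1).1 (ext_P P m.+1).2 (ext_P P m).1 (ext_P P m).2.
Proof. by case: m. Qed.

Lemma inhabited_pcf (R : realType) (alpha p : R) :
  irrational alpha -> 0 < p -> inhabited (pcf p alpha).
Proof.
move=> irr p0; have [t [P [step0 stepS]]] := exists_pcf_points irr p0.
have sr m : {sr : int * int | P m = lpoint alpha sr.1 sr.2}.
  apply: cid; have [_ _ [/lattice_ofP[s [r e]] _ _ _ _]] := pcf_reduced irr p0 step0 stepS m.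
  by exists (s, r).
pose s m := (sval (sr m)).1; pose r m := (sval (sr m)).2.
have PE m : P m = lpoint alpha (s m) (r m) := svalP (sr m).
have sE m : (s m)%:~R = (P m).1 by rewrite PE.
have rE m : (r m)%:~R = (P m).2 + (P m).1 * alpha by rewrite PE subrK.
pose W := wedge (ext_s s) (ext_r s r).
have W0 m : (W m.+1 m)%:~R != 0 :> R.
  rewrite intr_eq0; apply: (wedge_neq0 irr p0 step0 stepS sE rE).
  by rewrite gtn_eqF.
have WE i j := wedgeE sE rE i j.
have detE m : \det (pcf_mx P m) = (W m.+1 m)%:~R by rewrite pcf_mx_ext det_mx22 WE.
(* Cramer's rule for the first row of the matrix recurrence; the determinant factors in [ra] and
   [re] then clear the denominators. *)
pose ta n : rat := if n is m.+1 then (W m.+2 m)%:~R / (W m.+1 m)%:~R else 0.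
pose te n : rat := if n is m.+1 then - (W m.+2 m.+1)%:~R / (W m.+1 m)%:~R else 0.
have taE m : ratr (ta m.+1) = (W m.+2 m)%:~R / (W m.+1 m)%:~R :> R.
  by rewrite fmorph_div/= !ratr_int.
have teE m : ratr (te m.+1) = - (W m.+2 m.+1)%:~R / (W m.+1 m)%:~R :> R.
  by rewrite fmorph_div rmorphN/= !ratr_int.
pose ra n := if n is m.+1 then W m.+2 m else 0.
pose re n := if n is k.+1 then
  if k is m.+1 then - (W m.+1 m * W m.+3 m.+2) else - W 2 1 else 0.
constructor; apply: (@Build_pcf R p alpha t P step0 stepS s r sE rE ta te _ ra re).
- move=> m; rewrite !pcf_mx_ext mul_mx22 taE teE.
  have := W0 m; rewrite /W !WE => h.
  by congr mx22; field.
- by move=> m; rewrite detE taE mulrC divfK.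
- by rewrite detE teE mulrC divfK// rmorphN.
- move=> m; rewrite !detE teE rmorphN rmorphM -mulrA [_ * (_ / _)]mulrC divfK//.
  by rewrite mulrN.
Qed.

(** * Coefficients expressed by determinants *)

Section coefficients.
Variables (R : realType) (alpha p : R) (c : pcf p alpha).
Hypotheses (irr : irrational alpha) (p0 : 0 < p).
Local Notation W := (wedge (ext_s (pcf_s c)) (ext_r (pcf_s c) (pcf_r c))).
Local Notation div := (gcd_div (pcf_ra c) (pcf_re c)).

Lemma pcf_detE m : \det (pcf_mx (pcf_P c) m) = (W m.+1 m)%:~R.
Proof. by rewrite pcf_mx_ext det_mx22 (wedgeE (pcf_sE c) (pcf_rE c)). Qed.

Lemma pcf_W_neq0 i j : i != j -> W i j != 0.
Proof.
exact: (wedge_neq0 irr p0 (pcf_init c) (pcf_next c) (pcf_sE c) (pcf_rE c)).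
Qed.

Lemma pcf_recurrence m : let Q := ext_P (pcf_P c) in
  (Q m.+2).1 = ratr (pcf_ta c m.+1) * (Q m.+1).1 + ratr (pcf_te c m.+1) * (Q m).1 /\
  (Q m.+2).2 = ratr (pcf_ta c m.+1) * (Q m.+1).2 + ratr (pcf_te c m.+1) * (Q m).2.
Proof.
by have := pcf_mxE c m; rewrite !pcf_mx_ext mul_mx22 => /mx22_inj.
Qed.

(** Inserting the recurrence into the determinant of rows m + 2 and m kills the repeated row,
    leaving the tilde coefficient times det g_m. *)
Lemma pcf_ra_wedge m : pcf_ra c m.+1 = W m.+2 m.
Proof.
apply: (@intr_inj R); rewrite pcf_raE pcf_detE !(wedgeE (pcf_sE c) (pcf_rE c)).
have [-> ->] := pcf_recurrence m; ring.
Qed.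

Lemma pcf_te_wedge m : (W m.+1 m)%:~R * ratr (pcf_te c m.+1) = - (W m.+2 m.+1)%:~R :> R.
Proof.
rewrite !(wedgeE (pcf_sE c) (pcf_rE c)); have [-> ->] := pcf_recurrence m; ring.
Qed.

Lemma pcf_re1_wedge : pcf_re c 1 = - W 2 1.
Proof.
by apply: (@intr_inj R); rewrite pcf_re1E pcf_detE pcf_te_wedge rmorphN.
Qed.

Lemma pcf_re_wedge m : pcf_re c m.+2 = - (W m.+1 m * W m.+3 m.+2).
Proof.
apply: (@intr_inj R); rewrite pcf_reE !pcf_detE -mulrA pcf_te_wedge.
by rewrite rmorphN rmorphM mulrN.
Qed.

Lemma pcf_re_neq0 n : pcf_re c n.+1 != 0.
Proof.
case: n => [|n]; rewrite ?pcf_re1_wedge ?pcf_re_wedge oppr_eq0 ?mulf_neq0//;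
  by rewrite pcf_W_neq0// gtn_eqF.
Qed.

Lemma pcf_a_div n : pcf_a c n.+1 * div n.+1 = W n.+2 n.
Proof. by rewrite /pcf_a gcd_steps_fst pcf_ra_wedge. Qed.

Lemma pcf_eps_div n : pcf_eps c n.+1 * (div n * div n.+1) = pcf_re c n.+1.
Proof.
by rewrite /pcf_eps [div n * _]mulrC mulrA gcd_steps_snd gcd_steps_next.
Qed.

Lemma pcf_cfrac_conv n : pcf_cfrac c n = pcf_conv c n.
Proof.
pose x k : rat := (ext_s (pcf_s c) k)%:~R.
pose y k : rat := (ext_r (pcf_s c) (pcf_r c) k)%:~R.
have wE i j : wedge x y i j = (W i j)%:~R by rewrite [in RHS]/wedge intrB !intrM.
rewrite /pcf_cfrac (@cfrac_convergent x y (fun k => (div k)%:~R))//.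
- by move=> i j ij; rewrite wE intr_eq0 pcf_W_neq0.
- by move=> k; rewrite intr_eq0 gcd_div_neq0//; exact: pcf_re_neq0.
- by move=> k; rewrite wE -pcf_a_div intrM.
- by move=> k; rewrite !wE -!intrM pcf_eps_div pcf_re_wedge rmorphN.
- by have := pcf_eps_div 0; rewrite mul1r pcf_re1_wedge wE -intrM => ->; rewrite rmorphN.
- move=> k; rewrite intr_eq0 gt_eqF//.
  exact: (pcf_s_gt0 irr p0 (pcf_init c) (pcf_next c) (pcf_sE c)).
Qed.

Lemma pcf_gcd n : (1 <= n)%N ->
  gcdz (gcdz (pcf_eps c n) (pcf_a c n)) (pcf_eps c n.+1) = 1.
Proof. by case: n => // n _; apply: gcd_steps_coprime; exact: pcf_re_neq0. Qed.

Lemma pcf_eps_le n : `|(pcf_eps c n.+1)%:~R : R| <= `|(pcf_re c n.+1)%:~R|.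
Proof.
rewrite -pcf_eps_div intrM normrM ler_peMr// -intr_norm ler1z -gtz0_ge1.
by rewrite normr_gt0 mulf_neq0//; apply: gcd_div_neq0; exact: pcf_re_neq0.
Qed.

(** The hypothesis bounds |r/s - alpha| by K / s^2, and the denominators satisfy s_n > n. *)
Lemma pcf_conv_cvg K : (forall n, (pcf_s c n)%:~R *
    `|(pcf_r c n)%:~R - (pcf_s c n)%:~R * alpha| < K) ->
  (ratr (pcf_conv c n) : R) @[n --> \oo] --> alpha.
Proof.
move=> bnd; apply/cvgrPdist_lt => e e0; near=> n.
have sn : n%:R < (pcf_s c n)%:~R :> R.
  rewrite -[n%:R]/(n%:Z%:~R) ltr_int.
  exact: (pcf_s_ge irr p0 (pcf_init c) (pcf_next c) (pcf_sE c)).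
have s1 : 1 <= (pcf_s c n)%:~R :> R.
  rewrite ler1z -gtz0_ge1.
  exact: (pcf_s_gt0 irr p0 (pcf_init c) (pcf_next c) (pcf_sE c)).
have Kn : K / e < n%:R by near: n; exact: nbhs_infty_gtr.
rewrite /pcf_conv fmorph_div/= !ratr_int distrC.
have := bnd n; move: sn s1; set s : R := (pcf_s c n)%:~R; set r : R := _%:~R.
move=> sn s1 lt; have s0 : 0 < s by lra.
rewrite (_ : r / s - alpha = (r - s * alpha) / s); last by field; rewrite gt_eqF.
rewrite normrM normfV (gtr0_norm s0) ltr_pdivrMr//.
rewrite -(ltr_pM2l s0) (lt_le_trans lt)//.
have : K < e * s by rewrite mulrC -ltr_pdivrMr// (lt_trans Kn).
move=> /ltW /le_trans; apply.
by rewrite ler_peMl// mulr_ge0 ?(ltW e0) ?(ltW s0).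
Unshelve. all: by end_near.
Qed.

End coefficients.

Theorem theorem1p1 (R : realType) (delta : R) (hdelta : 0 < delta) :
  exists p : R, 0 < p < 1 /\
  exists M : R, forall alpha : R, irrational alpha ->
    inhabited (pcf p alpha) /\
    forall c : pcf p alpha,
    [/\ [/\ forall n, pcf_cfrac c n = pcf_conv c n,
            (ratr (pcf_cfrac c n) : R) @[n --> \oo] --> alpha
          & forall n, (1 <= n)%N ->
              gcdz (gcdz (pcf_eps c n) (pcf_a c n)) (pcf_eps c n.+1) = 1],
        forall q : rat, (exists n, q = pcf_conv c n) <-> Lp_best_approx p alpha q,
        forall n, (pcf_s c n)%:~R * `|(pcf_r c n)%:~R - (pcf_s c n)%:~R * alpha|
                    < (Num.sqrt 5)^-1 + delta
      & forall n, (1 <= n)%N -> `|(pcf_eps c n)%:~R : R| <= M].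
Proof.
pose k : R := (Num.sqrt 5)^-1.
have k0 : 0 < k by rewrite invr_gt0 sqrtr_gt0.
have k5 : 5 * k ^+ 2 = 1 by rewrite exprVn sqr_sqrtr// mulfV.
have k7 : k <= 7 ^+ 2 by nra.
(* The constant 7 is the side of the box in [small_lattice_point]. *)
have [p [p01 bound]] := powR_sum_bound k0 hdelta (ltr0Sn R 6) k7.
have /andP[p0 _] := p01.
exists p; split => //; exists (wedge_bound p k delta ^+ 2) => alpha irr.
split; first exact: inhabited_pcf.
move=> c.
have step0 := pcf_init c; have stepS := pcf_next c.
have sE := pcf_sE c; have rE := pcf_rE c.
have bnd n : (pcf_s c n)%:~R * `|(pcf_r c n)%:~R - (pcf_s c n)%:~R * alpha| < k + delta.
  have t1 := pcf_t_gt1 irr p0 step0 stepS n.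
  have := minimal_mul_lt irr p0 k0 k5 hdelta bound (ltW t1) (pcf_min irr p0 step0 stepS n).
  rewrite normrM (gtr0_norm (x := (pcf_P c n).1)); last first.
    by have [] := pcf_reduced irr p0 step0 stepS n.
  by rewrite rE sE addrK.
have wb := wedge_le irr p0 step0 stepS sE rE k0 k5 bound.
have wb1 : 1 <= wedge_bound p k delta.
  have B0 := @coord_bound_ge0 _ p k delta.
  have := sqr_ge0 (coord_bound p k delta); have := exprn_ge0 4 B0.
  rewrite /wedge_bound; lra.
split => //.
- split; first exact: pcf_cfrac_conv.
  + under eq_fun do rewrite pcf_cfrac_conv//.
    exact: pcf_conv_cvg bnd.
  + exact: pcf_gcd.
- move=> q; split => [[n ->]|].
    exact: (conv_best_approx irr p0 step0 stepS sE rE n).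
  apply: (best_approx_conv irr p0 step0 stepS sE rE).
  exact: (pcf_t_unbounded irr p0 step0 stepS sE k0 k5 bound).
- case=> // n _; apply: le_trans (pcf_eps_le c irr p0 n) _.
  case: n => [|n]; rewrite ?pcf_re1_wedge ?pcf_re_wedge// rmorphN normrN.
    (* For n = 1 only one determinant occurs; its bound is at least 1, hence at most its square. *)
    by rewrite (le_trans (wb 1%N))// expr2 ler_peMr//; lra.
  by rewrite rmorphM normrM expr2 ler_pM ?normr_ge0 ?wb.
Qed.
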